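(* The family $s\mapsto \gamma_+^s * \mathrm{li}_0$ is an entire family of tempered distributions on $\mathbb{R}$. That is: for every $s\in\mathbb{C}$ and every Schwartz function $f\in\mathcal{S}(\mathbb{R})$ the principal value $$\langle \gamma_+^s*\mathrm{li}_0,f\rangle=\mathrm{PV}\int_{-\infty}^{\infty}\frac{1}{e^{-t}-1}\,\langle\gamma_+^s, f(\cdot+t)\rangle\,dt$$ is well defined; for every $s\in\mathbb{C}$ the map $f\mapsto\langle \gamma_+^s*\mathrm{li}_0,f\rangle$ is a tempered distribution; and for every $f\in\mathcal{S}(\mathbb{R})$ the function $s\mapsto \langle \gamma_+^s*\mathrm{li}_0,f\rangle$ is entire.
   Context: $\mathcal{S}(\mathbb{R})$ is the Schwartz space and $\mathcal{S}'(\mathbb{R})$ the space of tempered distributions with the weak topology. For $\mathrm{Re}\, s>0$, $\gamma_+^s$ is the tempered distribution given by the locally integrable function $\gamma_+^s(x)=x_+^{s-1}/\Gamma(s)$ (equal to $x^{s-1}/\Gamma(s)$ for $x>0$ and $0$ for $x<0$). It extends to an entire function of $s\in\mathbb{C}$ with values in $\mathcal{S}'(\mathbb{R})$; explicitly, for $k\in\mathbb{N}$ and $\mathrm{Re}\, s>-k$, $\langle\gamma_+^s,f\rangle=\frac{(-1)^k}{\Gamma(s+k)}\int_0^\infty x^{s+k-1}f^{(k)}(x)\,dx$. $\mathrm{li}_0$ is the tempered distribution $\mathrm{PV}\frac{1}{e^{-x}-1}$, i.e. $\langle \mathrm{li}_0,f\rangle=\lim_{\epsilon\to0^+}\int_{|x|>\epsilon}\frac{f(x)}{e^{-x}-1}\,dx$.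 The principal value integral in the claim is $\lim_{\epsilon\to 0^+}\int_{|t|>\epsilon}$. *)

(* Defs.v *)
From HB Require Import structures.
From mathcomp Require Import all_boot all_order all_algebra.
From mathcomp Require Import complex.
From mathcomp Require Import all_classical all_reals all_analysis.

Set Implicit Arguments.
Unset Strict Implicit.
Unset Printing Implicit Defensive.

Import Order.TTheory GRing.Theory Num.Theory.
Import numFieldNormedType.Exports.
Import ComplexField.Normc.

Local Open Scope classical_set_scope.
Local Open Scope ring_scope.
Local Open Scope complex_scope.

Section Defs.
Variable R : realType.
Local Notation C := (R[i]).
Local Notation Re := (@complex.Re R).
Local Notation Im := (@complex.Im R).
Local Notation mu := (@lebesgue_measure R).

Definition cintegrable (D : set R) (g : R -> C) : Prop :=
  mu.-integrable D (EFin \o (Re \o g)) /\ mu.-integrable D (EFin \o (Im \o g)).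

Definition cintegral (D : set R) (g : R -> C) : C :=
  Rintegral mu D (Re \o g) +i* Rintegral mu D (Im \o g).

(* R[i] carries no normed structure over R in the library, so functions of a
   real variable are differentiated componentwise. *)
Definition cderiven (n : nat) (f : R -> C) : R -> C :=
  fun x => derive1n n (Re \o f) x +i* derive1n n (Im \o f) x.

Definition csmooth (f : R -> C) : Prop :=
  forall (n : nat) (x : R),
    derivable (derive1n n (Re \o f)) x 1 /\
    derivable (derive1n n (Im \o f)) x 1.

Definition schwartz_weights (m n : nat) (f : R -> C) : set R :=
  range (fun x : R => `|x| ^+ m * normc (cderiven n f x)).

Definition schwartz (f : R -> C) : Prop :=
  csmooth f /\ forall m n : nat, has_ubound (schwartz_weights m n f).

Definition schwartz_seminorm (m n : nat) (f : R -> C) : R :=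
  sup (schwartz_weights m n f).

(* Functionals are total on R -> C; only their values on Schwartz functions
   matter. Continuity is with respect to the locally convex topology given by
   the seminorms above, whose basic neighbourhoods of f are the sets of g with
   finitely many seminorms of g - f less than delta. *)
Definition tempered_distribution (T : (R -> C) -> C) : Prop :=
  (forall (a : C) (f g : R -> C), schwartz f -> schwartz g ->
     T (fun x => a * f x + g x) = a * T f + T g) /\
  (forall f : R -> C, schwartz f -> forall e : R, 0 < e ->
     exists N : nat, exists2 delta : R, 0 < delta &
       forall g : R -> C, schwartz g ->
         (forall m n : nat, (m <= N)%N -> (n <= N)%N ->
            schwartz_seminorm m n (fun x => g x - f x) < delta) ->
         normc (T g - T f) < e).

(* x ^ z = exp (z ln x), meant for x > 0 only. *)
Definition cpow (x : R) (z : C) : C :=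
  (x `^ Re z * cos (Im z * ln x)) +i* (x `^ Re z * sin (Im z * ln x)).

(* Euler's integral, meant for Re z > 0 only. *)
Definition cGamma (z : C) : C :=
  cintegral `]0, +oo[ (fun x => cpow x (z - 1) * (expR (- x))%:C).

Definition gamma_plus_at (k : nat) (s : C) (f : R -> C) : C :=
  (-1) ^+ k / cGamma (s + k%:R) *
  cintegral `]0, +oo[ (fun x => cpow x (s + k%:R - 1) * cderiven k f x).

(* The least k with Re s > - k. *)
Definition gamma_order (s : C) : nat :=
  if 0 < Re s then 0%N else (Num.truncn (- Re s)).+1.

Lemma gamma_orderP (s : C) (k : nat) :
  (- k%:R < Re s) = (gamma_order s <= k)%N.
Proof.
rewrite /gamma_order; case: ifPn => [s0|].
  by rewrite leq0n; apply: (le_lt_trans _ s0); rewrite oppr_le0.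
by rewrite -leNgt -oppr_ge0 ltrNl => s0; rewrite truncn_lt_nat.
Qed.

(* <gamma_+^s, f>. All k with Re s > - k give the same value of gamma_plus_at
   on Schwartz functions; for Re s > 0 the order used is 0, so that gamma_+^s
   is the function x_+^(s-1) / Gamma(s). *)
Definition gamma_plus (s : C) (f : R -> C) : C :=
  gamma_plus_at (gamma_order s) s f.

Definition li0_integrand (g : R -> C) : R -> C :=
  fun t => ((expR (- t) - 1)^-1)%:C * g t.

(* R[i]^o is R[i] with its normed-space structure over itself. *)
Definition li0_truncated (g : R -> C) (e : R) : C^o :=
  cintegral [set t | e < `|t|] (li0_integrand g).

Definition li0_well_defined (g : R -> C) : Prop :=
  (forall e : R, 0 < e -> cintegrable [set t | e < `|t|] (li0_integrand g)) /\
  cvg (li0_truncated g e @[e --> 0^'+]).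

(* PV int g(t) / (e^(-t) - 1) dt, for an arbitrary function g. *)
Definition li0 (g : R -> C) : C := lim (li0_truncated g e @[e --> 0^'+]).

(* t |-> <gamma_+^s, f(. + t)> *)
Definition gamma_plus_shift (s : C) (f : R -> C) : R -> C :=
  fun t => gamma_plus s (fun x => f (x + t)).

Definition gamma_li0 (s : C) (f : R -> C) : C := li0 (gamma_plus_shift s f).

(* The increment of derivable is complex since the domain is C^o over C, so
   this is complex differentiability on the whole plane. *)
Definition entire (F : C -> C) : Prop :=
  forall s : C^o, derivable (F : C^o -> C^o) s 1.

End Defs.

(* Main.v *)
Require Import Defs.
From mathcomp Require Import all_boot all_order all_algebra.
From mathcomp Require Import complex.
From mathcomp Require Import all_classical all_reals all_analysis.
From mathcomp Require Import measurable_realfun.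
From mathcomp Require Import ring lra zify.

Set Implicit Arguments.
Unset Strict Implicit.
Unset Printing Implicit Defensive.

Import Order.TTheory GRing.Theory Num.Theory.
Import numFieldNormedType.Exports.
Import ComplexField.Normc.

Local Open Scope classical_set_scope.
Local Open Scope ring_scope.
Local Open Scope complex_scope.

(* For large k put z = s + k, so that Re z > 0, and let g = f^(k).  The function
   t |-> <gamma_+^s, f(. + t)> is (-1)^k / Gamma(z) times
   phi(t) = int_0^oo x^(z-1) g(x + t) dx.  Every integral over x is controlled by
   one weight with an explicit primitive, wt a x, the derivative of
   (x / (1 + x))^a / a; together with Peetre's inequality it shows that phi grows
   at most polynomially, that phi(t) = O((1 + t)^-2) for t > 0 and that phi is
   locally Lipschitz.  Folding the principal value at 0 turns it into the
   absolutely convergent integral over t > 0 of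
   (phi(-t) - phi(t)) / (e^t - 1) - phi(t), which is bounded by a constant times
   the product of a weighted norm of the kernel x^(z-1) and finitely many
   seminorms of f.  Boundedness in f is temperedness; boundedness and linearity in
   the kernel give the derivative in z, because
   x^(z+h-1) - x^(z-1) - h ln x x^(z-1) has weighted norm O(|h|^2).
   The same argument differentiates Gamma.  Integration by parts gives
   Gamma(z + 1) = z Gamma(z) and the independence of k, and Gamma has no zero
   since a zero z would propagate to z + n, while Gamma(z + n) is nonzero for
   large n: there the mass of x^(Re z + n - 1) e^(-x) concentrates where
   x^(i Im z) hardly varies. *)

(** * Integrals of complex-valued functions *)

Section ComplexIntegral.
Variable R : realType.
Local Notation C := (R[i]).
Local Notation Re := (@complex.Re R).
Local Notation Im := (@complex.Im R).
Local Notation mu := (@lebesgue_measure R).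
Implicit Types (z w : C) (x y : R) (D : set R) (f g : R -> C).

Lemma complex_ext z w : Re z = Re w -> Im z = Im w -> z = w.
Proof. by case: z w => [a b] [c d] /= -> ->. Qed.

Lemma cReM z w : Re (z * w) = Re z * Re w - Im z * Im w.
Proof. by case: z w => [a b] [c d]. Qed.

Lemma cImM z w : Im (z * w) = Re z * Im w + Im z * Re w.
Proof. by case: z w => [a b] [c d]. Qed.

Lemma cReD z w : Re (z + w) = Re z + Re w.
Proof. by case: z w => [a b] [c d]. Qed.

Lemma cImD z w : Im (z + w) = Im z + Im w.
Proof. by case: z w => [a b] [c d]. Qed.

Lemma cReN z : Re (- z) = - Re z.
Proof. by case: z => [a b]. Qed.

Lemma cImN z : Im (- z) = - Im z.
Proof. by case: z => [a b]. Qed.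

Definition cReImE := (cReM, cImM, cReD, cImD, cReN, cImN).

Lemma Re_nat n : Re n%:R = n%:R.
Proof. by elim: n => // n IH; rewrite -!natr1 cReD IH. Qed.

Lemma Im_nat n : Im n%:R = 0.
Proof. by elim: n => // n IH; rewrite -!natr1 cImD IH addr0. Qed.

Lemma le_of_eq x y : x = y -> x <= y.
Proof. by move->. Qed.

Lemma normc_ge0 z : 0 <= normc z.
Proof. by case: z => a b; exact: sqrtr_ge0. Qed.

Lemma normc_ge_normRe z : `|Re z| <= normc z.
Proof.
by case: z => a b /=; rewrite -sqrtr_sqr ler_sqrt ?lerDl ?sqr_ge0// addr_ge0 ?sqr_ge0.
Qed.

Lemma normc_ge_normIm z : `|Im z| <= normc z.
Proof.
by case: z => a b /=; rewrite -sqrtr_sqr ler_sqrt ?lerDr ?sqr_ge0// addr_ge0 ?sqr_ge0.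
Qed.

Lemma normc_le_ReIm z : normc z <= `|Re z| + `|Im z|.
Proof.
case: z => a b /=.
have ab0 : 0 <= `|a| + `|b| by rewrite addr_ge0.
rewrite -[leRHS]ger0_norm// -sqrtr_sqr ler_sqrt ?sqr_ge0//.
rewrite sqrrD !real_normK ?num_real// -addrA lerD2l lerDr.
by rewrite mulrn_wge0 ?mulr_ge0.
Qed.

Lemma normc_real x : normc x%:C = `|x|.
Proof. by rewrite /= expr0n addr0 sqrtr_sqr. Qed.

Lemma le_normcB z w : normc (z - w) <= normc z + normc w.
Proof. by rewrite (le_trans (le_normcD _ _))// normcN. Qed.

Definition cmeasurable D f :=
  measurable_fun D (Re \o f) /\ measurable_fun D (Im \o f).

Lemma cmeasurableM D f g : cmeasurable D f -> cmeasurable D g ->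
  cmeasurable D (fun x => f x * g x).
Proof.
move=> [f1 f2] [g1 g2]; split.
  rewrite (_ : _ \o _ = (Re \o f) \* (Re \o g) \- (Im \o f) \* (Im \o g)).
    by apply: measurable_funB; apply: measurable_funM.
  by apply/funext => x /=; rewrite cReM.
rewrite (_ : _ \o _ = (Re \o f) \* (Im \o g) \+ (Im \o f) \* (Re \o g)).
  by apply: measurable_funD; apply: measurable_funM.
by apply/funext => x /=; rewrite cImM.
Qed.

Lemma cmeasurableD D f g : cmeasurable D f -> cmeasurable D g ->
  cmeasurable D (fun x => f x + g x).
Proof.
move=> [f1 f2] [g1 g2]; split.
  rewrite (_ : _ \o _ = (Re \o f) \+ (Re \o g)); first exact: measurable_funD.
  by apply/funext => x /=; rewrite cReD.
rewrite (_ : _ \o _ = (Im \o f) \+ (Im \o g)); first exact: measurable_funD.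
by apply/funext => x /=; rewrite cImD.
Qed.

Lemma cmeasurable_cst D z : cmeasurable D (fun=> z).
Proof. by split; exact: measurable_cst. Qed.

Lemma cmeasurable_real D (b : R -> R) : measurable_fun D b ->
  cmeasurable D (fun x => (b x)%:C).
Proof. by move=> mb; split => //; exact: measurable_cst. Qed.

Lemma cmeasurableB D f g : cmeasurable D f -> cmeasurable D g ->
  cmeasurable D (fun x => f x - g x).
Proof.
move=> mf mg.
rewrite (_ : (fun x => _) = fun x => f x + (-1) * g x).
  by apply: cmeasurableD => //; apply: cmeasurableM => //; exact: cmeasurable_cst.
by apply/funext => x; rewrite mulN1r.
Qed.

Lemma cmeasurable_comp f (h : R -> R) D : measurable_fun D h ->
  cmeasurable setT f -> cmeasurable D (f \o h).
Proof.
by move=> mh [f1 f2]; split; rewrite compA; apply: measurableT_comp.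
Qed.

Lemma integrable_EFinZ D (r : R) (h : R -> R) : measurable D ->
  mu.-integrable D (EFin \o h) -> mu.-integrable D (EFin \o (fun x => r * h x)).
Proof.
move=> mD ih; rewrite (_ : _ \o _ = (fun x => r%:E * (EFin \o h) x)%E)//.
exact: integrableZl.
Qed.

Lemma integrable_EFinD D (h k : R -> R) : measurable D ->
  mu.-integrable D (EFin \o h) -> mu.-integrable D (EFin \o k) ->
  mu.-integrable D (EFin \o (fun x => h x + k x)).
Proof.
move=> mD ih ik.
rewrite (_ : _ \o _ = (fun x => (EFin \o h) x + (EFin \o k) x)%E)//.
exact: integrableD.
Qed.

Lemma integrable_EFinB D (h k : R -> R) : measurable D ->
  mu.-integrable D (EFin \o h) -> mu.-integrable D (EFin \o k) ->
  mu.-integrable D (EFin \o (fun x => h x - k x)).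
Proof.
move=> mD ih ik.
rewrite (_ : _ \o _ = (fun x => (EFin \o h) x - (EFin \o k) x)%E)//.
exact: integrableB.
Qed.

Lemma eq_cintegral D f g : {in D, f =1 g} -> cintegral D f = cintegral D g.
Proof.
by move=> fg; rewrite /cintegral; congr (_ +i* _); apply: eq_Rintegral => x xD /=;
  rewrite fg.
Qed.

Lemma cintegrable_dominated D (b : R -> R) f : measurable D -> cmeasurable D f ->
  mu.-integrable D (EFin \o b) -> (forall x, D x -> normc (f x) <= b x) ->
  cintegrable D f.
Proof.
move=> mD [f1 f2] ib fb.
have H (h : C -> R) : measurable_fun D (h \o f) -> (forall z, `|h z| <= normc z) ->
    mu.-integrable D (EFin \o (h \o f)).
  move=> mh hn; apply: le_integrable ib => //; first exact/measurable_EFinP.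
  move=> x Dx /=; rewrite lee_fin (le_trans (hn _))// (le_trans (fb _ Dx))//.
  by rewrite ler_norm.
by split; apply: H => // z; [exact: normc_ge_normRe|exact: normc_ge_normIm].
Qed.

(** The real and imaginary parts are each bounded by the integral of [b], which costs the factor
    2. *)
Lemma normc_cintegral_le D (b : R -> R) f : measurable D -> cmeasurable D f ->
  mu.-integrable D (EFin \o b) -> (forall x, D x -> normc (f x) <= b x) ->
  normc (cintegral D f) <= 2 * Rintegral mu D b.
Proof.
move=> mD mf ib fb.
have [i1 i2] := cintegrable_dominated mD mf ib fb.
have H (h : C -> R) : mu.-integrable D (EFin \o (h \o f)) -> (forall z, `|h z| <= normc z) ->
    `|Rintegral mu D (h \o f)| <= Rintegral mu D b.
  move=> ih hn; apply: (le_trans (le_normr_Rintegral _ _)) => //.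
  apply: le_Rintegral => //; first exact: (integrable_norm ih).
  by move=> x Dx; rewrite (le_trans (hn _))// fb.
rewrite (le_trans (normc_le_ReIm _))// mulr_natl mulr2n lerD//=; apply: H => // z.
  exact: normc_ge_normRe.
exact: normc_ge_normIm.
Qed.

Lemma cintegral_linear D z f g : measurable D -> cintegrable D f -> cintegrable D g ->
  cintegral D (fun x => z * f x + g x) = z * cintegral D f + cintegral D g.
Proof.
move=> mD [f1 f2] [g1 g2].
have Z r h := @integrable_EFinZ D r h mD.
apply: complex_ext => /=.
  under eq_Rintegral do rewrite /= cReD cReM.
  rewrite !cReImE /= RintegralD//; last by apply: integrable_EFinB => //; exact: Z.
  rewrite RintegralB; [|done|exact: Z|exact: Z].
  by rewrite !RintegralZl.
under eq_Rintegral do rewrite /= cImD cImM.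
rewrite !cReImE /= RintegralD//; last by apply: integrable_EFinD => //; exact: Z.
rewrite RintegralD; [|done|exact: Z|exact: Z].
by rewrite !RintegralZl.
Qed.

Lemma cintegrable_linear D z f g : measurable D -> cintegrable D f -> cintegrable D g ->
  cintegrable D (fun x => z * f x + g x).
Proof.
move=> mD [f1 f2] [g1 g2].
have Z r h := @integrable_EFinZ D r h mD.
split.
  rewrite (_ : Re \o _ = (fun x => (Re z * Re (f x) - Im z * Im (f x)) + Re (g x))).
    by apply: integrable_EFinD => //; apply: integrable_EFinB => //; exact: Z.
  by apply/funext => x /=; rewrite !cReImE.
rewrite (_ : Im \o _ = (fun x => (Re z * Im (f x) + Im z * Re (f x)) + Im (g x))).
  by apply: integrable_EFinD => //; apply: integrable_EFinD => //; exact: Z.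
by apply/funext => x /=; rewrite !cReImE.
Qed.

Lemma cintegralZ D z f : measurable D -> cintegrable D f ->
  cintegral D (fun x => z * f x) = z * cintegral D f.
Proof.
move=> mD [f1 f2].
have i0 : cintegrable D (fun=> 0) by split; exact: integrable0.
have -> : (fun x => z * f x) = fun x => z * f x + (fun=> 0) x.
  by apply/funext => x; rewrite addr0.
rewrite cintegral_linear// [X in _ + X](_ : _ = 0) ?addr0//.
by rewrite /cintegral /comp/= !Rintegral_cst//= !mul0r.
Qed.

Lemma cintegralD D f g : measurable D -> cintegrable D f -> cintegrable D g ->
  cintegral D (fun x => f x + g x) = cintegral D f + cintegral D g.
Proof.
move=> mD f1 g1; rewrite -[cintegral D f]mul1r -cintegral_linear//.
by apply: eq_cintegral => x _; rewrite mul1r.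
Qed.

Lemma cintegralB D f g : measurable D -> cintegrable D f -> cintegrable D g ->
  cintegral D (fun x => f x - g x) = cintegral D f - cintegral D g.
Proof.
move=> mD f1 g1; rewrite addrC -mulN1r -cintegral_linear//.
by apply: eq_cintegral => x _; rewrite mulN1r addrC.
Qed.

Lemma cintegral_setU D D' f : measurable D -> measurable D' ->
  cintegrable (D `|` D') f -> [disjoint D & D'] ->
  cintegral (D `|` D') f = cintegral D f + cintegral D' f.
Proof.
by move=> mD mD' [f1 f2] DD; apply: complex_ext; rewrite ?cReImE/=; apply: Rintegral_setU.
Qed.

(** Lebesgue measure is determined by its values on half-open intervals, and reflection sends []a,
    b]] to [[-b, -a[], which has the same length. *)
Lemma lebesgue_measure_opp (A : set R) : measurable A ->
  mu A = pushforward mu (-%R : R -> R) A.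
Proof.
have mopp : measurable_fun setT (-%R : measurableTypeR R -> measurableTypeR R).
  exact: oppr_measurable.
move=> mA.
apply: (@lebesgue_measure_unique R
  (pushforward mu (-%R : measurableTypeR R -> measurableTypeR R))) => //.
move=> X /ocitvP[->|[[a b] /= ab ->]]; first by rewrite !measure0.
rewrite /pushforward /= (_ : _ @^-1` _ = `[- b, - a[%classic); last first.
  by apply/seteqP; split => x /=; rewrite !in_itv/= lerNl ltrNr andbC.
by rewrite !lebesgue_measure_itv/= !lte_fin ltrN2 ab opprK addrC.
Qed.

Lemma Rintegral_opp D (h : R -> R) : measurable D -> measurable_fun setT h ->
  mu.-integrable ((-%R : R -> R) @^-1` D) (EFin \o (h \o -%R)) ->
  Rintegral mu D h = Rintegral mu ((-%R : R -> R) @^-1` D) (h \o -%R).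
Proof.
move=> mD mh ih; rewrite /Rintegral; congr fine.
have mopp : measurable_fun setT (-%R : measurableTypeR R -> measurableTypeR R).
  exact: oppr_measurable.
rewrite -(@integral_pushforward _ _ (measurableTypeR R) (measurableTypeR R) R
   (-%R : R -> R) mopp mu D (EFin \o h))//; last exact/measurable_EFinP.
by apply: eq_measure_integral => A mA _; exact: lebesgue_measure_opp.
Qed.

Lemma cintegral_opp D f : measurable D -> cmeasurable setT f ->
  cintegrable ((-%R : R -> R) @^-1` D) (f \o -%R) ->
  cintegral D f = cintegral ((-%R : R -> R) @^-1` D) (f \o -%R).
Proof.
by move=> mD [m1 m2] [i1 i2]; apply: complex_ext; rewrite /= Rintegral_opp.
Qed.

(** The open half-line is exhausted by the closed ones [[1/(n+1), +oo[], where the fundamental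
    theorem applies, and monotone convergence passes to the limit. Nonnegativity lets this prove
    integrability along with the value. *)
Lemma ge0_FTC_oy (f F : R -> R) (l0 l1 : R) :
  (forall x, 0 < x -> is_derive x 1 F (f x)) ->
  (forall x, 0 < x -> 0 <= f x) ->
  (forall x, 0 < x -> {for x, continuous f}) ->
  F x @[x --> 0^'+] --> l0 -> F x @[x --> +oo] --> l1 ->
  (\int[mu]_(x in `]0%R, +oo[) (f x)%:E = (l1 - l0)%:E)%E.
Proof.
move=> dF f0 cf F0 F1.
pose e (n : nat) : R := n.+1%:R^-1.
have e0 n : 0 < e n by rewrite invr_gt0.
have -> : `]0%R, +oo[%classic = \bigcup_n `[e n, +oo[%classic.
  apply/seteqP; split => x /=; last first.
    by move=> [n _] /=; rewrite !in_itv/= !andbT; apply: lt_le_trans.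
  rewrite in_itv/= andbT => x0; exists (Num.truncn x^-1) => //=.
  rewrite in_itv/= andbT /e -[leRHS]invrK lef_pV2 ?posrE ?invr_gt0//.
  by apply/ltW; rewrite truncnS_gt.
have cvg1 : (\int[mu]_(x in `[e n, +oo[) (f x)%:E @[n --> \oo] -->
   \int[mu]_(x in \bigcup_n `[e n, +oo[%classic) (f x)%:E)%E.
  apply: ge0_nondecreasing_set_cvg_integral => //.
  - move=> m n mn; apply/subsetPset => x /=; rewrite !in_itv/= !andbT.
    by apply: le_trans; rewrite lef_pV2 ?posrE// ler_nat.
  - move=> n; apply/measurable_EFinP.
    apply: (@measurable_funS _ _ (measurableTypeR R) _ `]0, +oo[%classic) => //.
      by move=> x /=; rewrite !in_itv/= !andbT; apply: lt_le_trans.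
    apply: open_continuous_measurable_fun; first exact: interval_open.
    by move=> x; rewrite inE/= in_itv/= andbT => /cf.
  - move=> n x /=; rewrite in_itv/= andbT => nx; rewrite lee_fin f0//.
    exact: lt_le_trans nx.
have E n : (\int[mu]_(x in `[e n, +oo[) (f x)%:E = (l1 - F (e n))%:E)%E.
  rewrite EFinB; apply: ge0_continuous_FTC2y => //.
  - by move=> x nx; rewrite f0// (lt_le_trans _ nx).
  - apply: continuous_in_subspaceT => x; rewrite inE/= in_itv/= andbT => nx.
    by apply: cf; rewrite (lt_le_trans _ nx).
  - by move=> x nx; have [] := dF x (lt_trans (e0 n) nx).
  - apply: cvg_at_right_filter.
    have [dd _] := dF _ (e0 n).
    by apply: differentiable_continuous; exact/derivable1_diffP.
  - move=> x; rewrite in_itv/= andbT => nx.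
    by have := dF x (lt_trans (e0 n) nx) => ?; rewrite derive1E; apply: derive_val.
have cvg2 : (l1 - F (e n))%:E @[n --> \oo] --> (l1 - l0)%:E.
  apply: cvg_EFin; first by near=> n.
  apply: (@cvgB _ _ _ _ _ (fun=> l1) (F \o e)); first exact: cvg_cst.
  apply: (cvg_at_rightP _ _ _).1 F0 _ _; split => // .
  apply/cvgrPdist_lt => eps eps0.
  have := near_infty_natSinv_lt (PosNum eps0).
  by apply: filterS => n /=; rewrite sub0r normrN ger0_norm ?invr_ge0.
have EE : (fun n => \int[mu]_(x in `[e n, +oo[) (f x)%:E)%E = (fun n => (l1 - F (e n))%:E).
  exact/funext.
rewrite EE in cvg1; exact: (cvg_unique _ cvg1 cvg2).
Unshelve. all: by end_near. Qed.

End ComplexIntegral.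

(** * The integrable weight and complex powers *)

Section Weight.
Variable R : realType.
Local Notation C := (R[i]).
Local Notation Re := (@complex.Re R).
Local Notation Im := (@complex.Im R).
Local Notation mu := (@lebesgue_measure R).
Implicit Types (z w h : C) (x y a b A : R) (N : nat).

(** Comparable to x^(a-1) near 0 and to x^(-2) at infinity, hence integrable on the half-line
    exactly when a > 0. *)
Definition wt a x : R := (x / (1 + x)) `^ (a - 1) / (1 + x) ^+ 2.

Lemma wt_ge0 a x : 0 <= wt a x.
Proof. by rewrite divr_ge0 ?powR_ge0 ?sqr_ge0. Qed.

Lemma wt1 x : wt 1 x = (1 + x) ^- 2.
Proof. by rewrite /wt subrr powRr0 div1r. Qed.

Lemma is_derive_wt a x : 0 < a -> 0 < x ->
  is_derive x 1 (fun y => (y / (1 + y)) `^ a / a) (wt a x).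
Proof.
move=> a0 x0.
have x1 : 1 + x != 0 by rewrite gt_eqF// addr_gt0.
have D1 : is_derive x 1 (fun y : R => y / (1 + y)) ((1 + x) ^- 2).
  have d1 : is_derive x 1 (cst 1 + id : R -> R) 1.
    by rewrite -[X in is_derive _ _ _ X]add0r; exact: is_deriveD.
  have d2 := @is_deriveV R (cst 1 + id : R -> R) x 1 1 x1 d1.
  have d3 := is_deriveM (is_derive_id x (1:R)) d2.
  apply: (is_derive_eq d3).
  by transitivity (x * (- (1 + x) ^- 2 * 1) + (1 + x)^-1 * 1); [by []|field].
have q0 : 0 < x / (1 + x) by rewrite divr_gt0 ?addr_gt0.
have D2 := @is_derive1_powR R a _ q0.
have D3 := @is_derive1_comp R ((@powR R)^~ a) (fun y : R => y / (1 + y)) x _ _ D2 D1.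
have D4 := is_deriveZ a^-1 D3.
rewrite (_ : (fun y => _) = a^-1 *: (((@powR R)^~ a) \o (fun y : R => y / (1 + y)))); last first.
  by apply/funext => y /=; rewrite [RHS]mulrC.
apply: (is_derive_eq D4); rewrite /GRing.scale/= /wt; field.
by rewrite x1 gt_eqF.
Qed.

Lemma continuous_wt a x : 0 < x -> {for x, continuous (wt a)}.
Proof.
move=> x0.
have x1 : 1 + x != 0 by rewrite gt_eqF// addr_gt0.
have q0 : 0 < x / (1 + x) by rewrite divr_gt0 ?addr_gt0.
have c1 : {for x, continuous (fun y : R => 1 + y)}.
  by apply: cvgD; [exact: cvg_cst|exact: cvg_id].
have c2 : {for x, continuous (fun y : R => y / (1 + y))}.
  by apply: cvgM; [exact: cvg_id|exact: cvgV].
apply: cvgM; last first.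
  apply: cvgV; first by rewrite expf_neq0.
  by apply: cvgM.
suff : {for x, continuous (((@powR R)^~ (a - 1)) \o (fun y : R => y / (1 + y)))} by [].
apply: continuous_comp => //.
apply: differentiable_continuous; apply/derivable1_diffP.
by apply: derivable_powR; rewrite in_itv/= q0.
Qed.

Lemma wt_primitive_cvg0 a : 0 < a ->
  (y / (1 + y)) `^ a / a @[y --> (0:R)^'+] --> (0:R).
Proof.
move=> a0; rewrite -[X in _ --> X](mul0r a^-1); apply: cvgM; last exact: cvg_cst.
apply: (@cvg_comp _ _ _ (fun y : R => y / (1 + y)) ((@powR R)^~ a) _ ((0:R)^'+)); last first.
  exact: powR_cvg0.
move=> /= S [e /= e0 eS].
exists e => //= y /= ye y0; apply: eS => /=; last by rewrite divr_gt0// addr_gt0.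
move: ye; rewrite !sub0r !normrN !gtr0_norm ?divr_gt0 ?addr_gt0//.
by apply: le_lt_trans; rewrite ler_pdivrMr ?addr_gt0// ler_peMr ?lerDl// ltW.
Qed.

Lemma wt_primitive_cvgy a : (y / (1 + y)) `^ a / a @[y --> +oo] --> a^-1.
Proof.
rewrite -[X in _ --> X](mul1r a^-1); apply: cvgM; last exact: cvg_cst.
rewrite -[X in _ --> X](congr1 (@^~ a) (powR1 R)).
apply: (@cvg_comp _ _ _ (fun y : R => y / (1 + y)) ((@powR R)^~ a) _ (nbhs (1:R))); last first.
  suff : {for (1:R), continuous ((@powR R)^~ a)} by [].
  apply: differentiable_continuous; apply/derivable1_diffP.
  by apply: derivable_powR; rewrite in_itv/= ltr01.
apply/cvgrPdist_lt => e e0; near=> y.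
have y0 : 0 < y by near: y; apply: nbhs_pinfty_gt; rewrite num_real.
(* The distance of y / (1 + y) from 1 is exactly 1 / (1 + y). *)
have y1 : 0 < 1 + y by rewrite addr_gt0.
rewrite (_ : 1 - y / (1 + y) = (1 + y)^-1); last by field; rewrite gt_eqF.
rewrite gtr0_norm ?invr_gt0// invf_plt ?posrE//.
have : e^-1 < y by near: y; apply: nbhs_pinfty_gt; rewrite num_real.
by move=> /lt_le_trans; apply; rewrite lerDr.
Unshelve. all: by end_near. Qed.

Lemma integral_wt a : 0 < a ->
  (\int[mu]_(x in `]0%R, +oo[) (wt a x)%:E = (a^-1)%:E)%E.
Proof.
move=> a0; rewrite -[a^-1]subr0.
apply: (@ge0_FTC_oy R (wt a) (fun y => (y / (1 + y)) `^ a / a)).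
- by move=> x x0; exact: is_derive_wt.
- by move=> x x0; exact: wt_ge0.
- by move=> x x0; exact: continuous_wt.
- exact: wt_primitive_cvg0.
- exact: wt_primitive_cvgy.
Qed.

Lemma measurable_oy (g : R -> R) : (forall x, 0 < x -> {for x, continuous g}) ->
  measurable_fun (`]0, +oo[%classic : set R) g.
Proof.
move=> cg; apply: open_continuous_measurable_fun; first exact: interval_open.
by move=> x; rewrite inE/= in_itv/= andbT => /cg.
Qed.

Lemma integrable_wt a : 0 < a -> mu.-integrable `]0, +oo[ (EFin \o wt a).
Proof.
move=> a0; apply/integrableP; split.
  apply/measurable_EFinP; apply: measurable_oy => x x0; exact: continuous_wt.
under eq_integral do rewrite /= ger0_norm ?wt_ge0//.
by rewrite integral_wt// ltry.
Qed.

Lemma Rintegral_wt a : 0 < a -> Rintegral mu `]0, +oo[ (wt a) = a^-1.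
Proof. by move=> a0; rewrite /Rintegral integral_wt. Qed.

(* The fundamental theorem for the nonnegative [f + A * wt a] and for [A * wt a]. *)
Lemma dominated_FTC_oy (f F : R -> R) (l0 l1 : R) a A : 0 < a -> 0 <= A ->
  (forall x, 0 < x -> is_derive x 1 F (f x)) ->
  (forall x, 0 < x -> {for x, continuous f}) ->
  (forall x, 0 < x -> `|f x| <= A * wt a x) ->
  F x @[x --> 0^'+] --> l0 -> F x @[x --> +oo] --> l1 ->
  Rintegral mu `]0, +oo[ f = l1 - l0.
Proof.
move=> a0 A0 dF cf fA F0 F1.
have moy : measurable (`]0, +oo[%classic : set R) by exact: measurable_itv.
have iw : mu.-integrable `]0, +oo[ (EFin \o (fun x => A * wt a x)).
  by apply: integrable_EFinZ => //; exact: integrable_wt.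
have if_ : mu.-integrable `]0, +oo[ (EFin \o f).
  apply: le_integrable iw => //; first by apply/measurable_EFinP; exact: measurable_oy.
  move=> x /=; rewrite in_itv/= andbT => x0; rewrite lee_fin (le_trans (fA _ x0))//.
  exact: ler_norm.
have E : Rintegral mu `]0, +oo[ (fun x => f x + A * wt a x) = (l1 + A * a^-1) - (l0 + A * 0).
  suff : (\int[mu]_(x in `]0%R, +oo[) (f x + A * wt a x)%:E =
      ((l1 + A * a^-1) - (l0 + A * 0))%:E)%E by rewrite /Rintegral => ->.
  apply: (@ge0_FTC_oy R _ (F \+ A *: (fun y => (y / (1 + y)) `^ a / a))).
  - move=> x x0; have d1 := dF _ x0; have d2 := is_derive_wt a0 x0.
    exact: (is_deriveD d1 (is_deriveZ A d2)).
  - move=> x x0; have := fA _ x0; rewrite ler_norml => /andP[+ _].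
    by rewrite lerNl -subr_ge0 opprK addrC.
  - move=> x x0; apply: cvgD; first exact: cf.
    by apply: cvgM; [exact: cvg_cst|exact: continuous_wt].
  - by apply: cvgD => //; apply: cvgM; [exact: cvg_cst|exact: wt_primitive_cvg0].
  - by apply: cvgD => //; apply: cvgM; [exact: cvg_cst|exact: wt_primitive_cvgy].
move: E; rewrite RintegralD// RintegralZl ?Rintegral_wt//; last exact: integrable_wt.
rewrite mulr0 addr0 => /(congr1 (fun t => t - A / a)); rewrite addrK => ->.
by rewrite addrAC addrK.
Qed.

Lemma cmeasurable_oy (f : R -> C) :
  (forall x, 0 < x -> {for x, continuous (Re \o f)}) ->
  (forall x, 0 < x -> {for x, continuous (Im \o f)}) ->
  cmeasurable (`]0, +oo[%classic : set R) f.
Proof. by move=> f1 f2; split; exact: measurable_oy. Qed.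

(** * Complex exponential and complex powers *)

Definition cexp w : C := (expR (Re w) * cos (Im w)) +i* (expR (Re w) * sin (Im w)).

Lemma cexpD z w : cexp (z + w) = cexp z * cexp w.
Proof.
by apply: complex_ext; rewrite !cReImE/= !cReImE expRD ?cosD ?sinD; ring.
Qed.

Lemma normc_cexp w : normc (cexp w) = expR (Re w).
Proof.
rewrite /cexp /= !exprMn -mulrDr cos2Dsin2 mulr1 sqrtr_sqr ger0_norm//.
Qed.

Lemma cpow_cexp x z : 0 < x -> cpow x z = cexp (z * (ln x)%:C).
Proof.
move=> x0; have e u : x `^ u = expR (u * ln x) by rewrite /powR gt_eqF.
by apply: complex_ext; rewrite /= !cReImE/= !e !mulr0 ?subr0 ?add0r.
Qed.

Lemma cpowD x z w : 0 < x -> cpow x (z + w) = cpow x z * cpow x w.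
Proof. by move=> x0; rewrite !cpow_cexp// mulrDl cexpD. Qed.

Lemma cpow_real x a : cpow x a%:C = (x `^ a)%:C.
Proof. by apply: complex_ext; rewrite /= mul0r ?cos0 ?sin0 ?mulr1 ?mulr0. Qed.

Lemma normc_cpow x z : 0 < x -> normc (cpow x z) = x `^ Re z.
Proof.
move=> x0; rewrite cpow_cexp// normc_cexp /powR gt_eqF//.
by rewrite !cReImE /= mulr0 subr0.
Qed.

Lemma is_derive_cpow x z : 0 < x ->
  is_derive x 1 (fun y => Re (cpow y z)) (Re (z * cpow x (z - 1))) /\
  is_derive x 1 (fun y => Im (cpow y z)) (Im (z * cpow x (z - 1))).
Proof.
move=> x0.
have dl := is_derive1_ln x0.
have dp : is_derive x 1 ((@powR R)^~ (Re z)) (Re z * x `^ (Re z - 1)) := is_derive1_powR _ x0.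
have dz : is_derive x 1 (fun y => Im z * ln y) (Im z * x^-1).
  exact: (is_deriveZ (Im z) dl).
have dc := is_derive1_comp (is_derive_cos _) dz.
have ds := is_derive1_comp (is_derive_sin _) dz.
have E : x^-1 * x `^ Re z = x `^ (Re z - 1).
  rewrite (@powRB R x (Re z) 1); last by apply/implyP => _; rewrite gt_eqF.
  by rewrite powRr1 ?ltW// mulrC.
have E1 : cpow x (z - 1) = x^-1%:C * cpow x z.
  rewrite cpowD// mulrC (_ : -1 = (-1)%:C); last by rewrite rmorphN.
  by rewrite cpow_real powR_inv1// ltW.
rewrite E1; split.
  apply: (is_derive_eq (is_deriveM dp dc)).
  by rewrite /GRing.scale/= !cReImE/= -E !mul0r ?addr0 ?subr0; ring.
apply: (is_derive_eq (is_deriveM dp ds)).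
by rewrite /GRing.scale/= !cReImE/= -E !mul0r ?addr0 ?subr0; ring.
Qed.

Lemma derive_continuous (f : R -> R) x (l : R) : is_derive x 1 f l ->
  {for x, continuous f}.
Proof.
by move=> [df _]; apply: differentiable_continuous; apply/derivable1_diffP.
Qed.

Lemma cmeasurable_cpow z : cmeasurable (`]0, +oo[%classic : set R) (fun x => cpow x z).
Proof.
by apply: cmeasurable_oy => x x0; have [d1 d2] := is_derive_cpow z x0;
  [exact: derive_continuous d1|exact: derive_continuous d2].
Qed.

End Weight.

(** * Elementary estimates *)

Section Estimates.
Variable R : realType.
Local Notation C := (R[i]).
Local Notation Re := (@complex.Re R).
Local Notation Im := (@complex.Im R).
Local Notation mu := (@lebesgue_measure R).
Implicit Types (z w h : C) (x y a b A u v : R) (N : nat).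

(** The mean value theorem, with the wlog removing any assumption on the order of the endpoints. *)
Lemma derive_bound (f df : R -> R) A x y : (forall u, is_derive u 1 f (df u)) ->
  (forall u, Num.min x y <= u <= Num.max x y -> `|df u| <= A) ->
  `|f y - f x| <= A * `|y - x|.
Proof.
move=> d; wlog xy : x y / x <= y.
  move=> H; have [xy|yx] := orP (le_total x y); first exact: H.
  by move=> B; rewrite distrC (distrC y); apply: H => // u; rewrite minC maxC; apply: B.
rewrite min_l// max_r// => B.
have [|c cxy ->] := @MVT_segment R f df x y xy (fun u _ => d u).
  apply: continuous_subspaceT => u; have [du _] := d u.
  by apply: differentiable_continuous; apply/derivable1_diffP.
by rewrite normrM ler_wpM2r// B.
Qed.

Lemma derive_bound0 (f df : R -> R) A v : (forall u, is_derive u 1 f (df u)) ->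
  (forall u, `|u| <= `|v| -> `|df u| <= A) -> `|f v - f 0| <= A * `|v|.
Proof.
move=> d B; rewrite -[X in _ * `|X|]subr0; apply: (derive_bound d) => u uv.
apply: B; case: (leP 0 v) uv => v0 /andP[u1 u2].
  by rewrite !ger0_norm.
by rewrite ler0_norm// ltr0_norm// lerN2.
Qed.

Lemma normr_sin_le v : `|sin v| <= `|v|.
Proof.
have := @derive_bound0 sin cos 1 v (fun u => is_derive_sin u) (fun u _ => cos_max u).
by rewrite sin0 subr0 mul1r.
Qed.

(** Between 0 and v the derivative is at most |v| by the linear bound on sin, so the mean value
    inequality yields a square. The second-order bounds for sin and exp below arise in the same
    way. *)
Lemma normr_cosB1_le v : `|cos v - 1| <= v ^+ 2.
Proof.
have : `|cos v - cos 0| <= `|v| * `|v|.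
  apply: (derive_bound0 (fun u => is_derive_cos u)) => u.
  by rewrite normrN; apply: le_trans (normr_sin_le u).
by rewrite cos0 -expr2 real_normK ?num_real.
Qed.

Lemma normr_sinB_le v : `|sin v - v| <= v ^+ 2.
Proof.
have d u : is_derive u 1 (sin \- id : R -> R) (cos u - 1).
  by apply: is_deriveB.
have : `|(sin \- id) v - (sin \- id : R -> R) 0| <= `|v| * `|v|.
  apply: (derive_bound0 d) => u uv; apply: le_trans uv.
  have := @derive_bound0 cos (fun u => - sin u) 1 u (fun u => is_derive_cos u).
  by rewrite cos0 mul1r; apply => t _; rewrite normrN sin_max.
by rewrite /= sin0 subrr subr0 -expr2 real_normK ?num_real.
Qed.

Lemma normr_expRB1_le u : `|expR u - 1| <= `|u| * expR `|u|.
Proof.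
have := @derive_bound0 expR expR (expR `|u|) u (fun t => is_derive_expR t).
rewrite expR0 mulrC; apply => t tu; rewrite ger0_norm ?expR_ge0// ler_expR.
by apply: le_trans tu; rewrite ler_norm.
Qed.

Lemma normr_expRB1B_le u : `|expR u - 1 - u| <= u ^+ 2 * expR `|u|.
Proof.
have d (t : R) : is_derive t 1 (expR \- id : R -> R) (expR t - 1).
  by apply: is_deriveB.
have : `|(expR \- id) u - (expR \- id : R -> R) 0| <= (`|u| * expR `|u|) * `|u|.
  apply: (derive_bound0 d) => t tu; rewrite (le_trans (normr_expRB1_le _))//.
  by rewrite ler_pM ?expR_ge0// ler_expR.
by rewrite /= expR0 subr0 mulrAC -expr2 real_normK ?num_real// addrAC.
Qed.

(** With w = u + iv, the real part splits as (e^u - 1 - u) + e^u (cos v - 1) and the imaginary part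
    as (e^u - 1) sin v + (sin v - v). Each of the four terms is at most |w|^2 e^|w|. *)
Lemma cexp_remainder w :
  normc (cexp w - 1 - w) <= 4 * normc w ^+ 2 * expR (normc w).
Proof.
set n := normc w.
have n0 : 0 <= n by exact: normc_ge0.
have un : `|Re w| <= n by exact: normc_ge_normRe.
have vn : `|Im w| <= n by exact: normc_ge_normIm.
have e1 : expR `|Re w| <= expR n by rewrite ler_expR.
have e2 : expR (Re w) <= expR n.
  by rewrite ler_expR (le_trans _ un)// ler_norm.
have en : 1 <= expR n by rewrite -expR0 ler_expR.
have u2 : Re w ^+ 2 <= n ^+ 2.
  by rewrite -[Re w ^+ 2]real_normK ?num_real// lerXn2r ?nnegrE.
have v2 : Im w ^+ 2 <= n ^+ 2.
  by rewrite -[Im w ^+ 2]real_normK ?num_real// lerXn2r ?nnegrE.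
have n2 : 0 <= n ^+ 2 by exact: sqr_ge0.
have E : n ^+ 2 <= n ^+ 2 * expR n by rewrite ler_peMr.
rewrite (le_trans (normc_le_ReIm _))// !cReImE /= subr0.
have H1 : `|expR (Re w) * cos (Im w) - 1 - Re w| <= 2 * (n ^+ 2 * expR n).
  rewrite (_ : _ - Re w =
    (expR (Re w) - 1 - Re w) + expR (Re w) * (cos (Im w) - 1)); last by ring.
  rewrite (le_trans (ler_normD _ _))// mulr_natl mulr2n lerD//.
    by rewrite (le_trans (normr_expRB1B_le _))// ler_pM ?sqr_ge0 ?expR_ge0.
  rewrite normrM mulrC ler_pM//; first exact: le_trans (normr_cosB1_le _) _.
  by rewrite ger0_norm ?expR_ge0.
have H2 : `|expR (Re w) * sin (Im w) - Im w| <= 2 * (n ^+ 2 * expR n).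
  rewrite (_ : _ - Im w = (expR (Re w) - 1) * sin (Im w) + (sin (Im w) - Im w)); last by ring.
  rewrite (le_trans (ler_normD _ _))// mulr_natl mulr2n lerD//; last first.
    exact: le_trans (normr_sinB_le _) (le_trans v2 E).
  rewrite normrM (@le_trans _ _ ((n * expR n) * n))//; last by rewrite mulrAC -expr2.
  rewrite ler_pM//; last exact: le_trans (normr_sin_le _) _.
  by rewrite (le_trans (normr_expRB1_le _))// ler_pM ?expR_ge0.
by rewrite (le_trans (lerD H1 H2))//; lra.
Qed.

(** After taking logarithms the claim reads (b - a) ln x <= (N - 1 - a) ln (1 + x), which follows
    from ln x <= ln (1 + x) and the two conditions on b. *)
Lemma powR_le_wt a b x N : 0 < a -> a <= b -> b + 1 <= N%:R -> 0 < x ->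
  x `^ (b - 1) <= wt a x * (1 + x) ^+ N.
Proof.
move=> a0 ab bN x0.
have x1 : 0 < 1 + x by rewrite addr_gt0.
have lm : ln x <= ln (1 + x) by rewrite ler_ln ?posrE// lerDr.
have m0 : 0 <= ln (1 + x) by rewrite ln_ge0// lerDl ltW.
have E M : (1 + x) ^+ M = expR (M%:R * ln (1 + x)) by rewrite expRM_natl lnK.
rewrite /wt !E /powR !gt_eqF ?divr_gt0// ln_div ?posrE// -expRN -!expRD ler_expR.
have : (b - a) * ln x <= (N%:R - 1 - a) * ln (1 + x).
  apply: (@le_trans _ _ ((b - a) * ln (1 + x))); first by rewrite ler_wpM2l ?subr_ge0.
  by rewrite ler_wpM2r//; lra.
by lra.
Qed.

(** The left side is one of the two powers, according to the sign of ln x. This is how logarithms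
    are absorbed into a shift of the exponent, at 0 and at infinity alike. *)
Lemma expR_normr_ln_le x b : 0 < x -> expR (b * `|ln x|) <= x `^ b + x `^ (- b).
Proof.
move=> x0; rewrite /powR gt_eqF//; case: (leP 0 (ln x)) => l0.
  by rewrite ger0_norm// lerDl expR_ge0.
by rewrite ltr0_norm// mulrN mulNr lerDr expR_ge0.
Qed.

Lemma normr_ln_le x b : 0 < b -> `|ln x| <= b^-1 * expR (b * `|ln x|).
Proof.
move=> b0; rewrite mulrC ler_pdivlMr// mulrC.
by rewrite (le_trans _ (expR_ge1Dx _))// lerDr.
Qed.

(** A weighted sup norm of [k] is at most [A]. The factor (1 + x)^N is to be compensated by the
    decay of the function against which [k] is integrated. *)
Definition kernel_bound a N A (k : R -> C) :=
  forall x, 0 < x -> normc (k x) <= A * (wt a x * (1 + x) ^+ N).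

Lemma kernel_cpow z a N : 0 < a -> a <= Re z -> Re z + 1 <= N%:R ->
  kernel_bound a N 1 (fun x => cpow x (z - 1)).
Proof.
move=> a0 az zN x x0; rewrite normc_cpow// mul1r !cReImE/=.
exact: powR_le_wt.
Qed.

(** The extra exponential moves the exponent b to b + a and b - a; the hypotheses keep both within
    the range of [powR_le_wt]. *)
Lemma powR_expR_le_wt b a x N : 0 < a -> 2 * a <= b -> b + a + 1 <= N%:R -> 0 < x ->
  x `^ (b - 1) * expR (a * `|ln x|) <= 2 * (wt a x * (1 + x) ^+ N).
Proof.
move=> a0 ab bN x0.
rewrite (le_trans (ler_wpM2l (powR_ge0 _ _) (expR_normr_ln_le a x0)))//.
have xn0 (p : bool) : p ==> (x != 0) by apply/implyP => _; rewrite gt_eqF.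
rewrite mulrDr -!powRD// mulr_natl mulr2n lerD//.
  rewrite (_ : b - 1 + a = b + a - 1); last by ring.
  by apply: powR_le_wt => //; lra.
rewrite (_ : b - 1 - a = b - a - 1); last by ring.
by apply: powR_le_wt => //; lra.
Qed.

Lemma kernel_log z a N : 0 < a -> 2 * a <= Re z -> Re z + a + 1 <= N%:R ->
  kernel_bound a N (2 / a) (fun x => (ln x)%:C * cpow x (z - 1)).
Proof.
move=> a0 az zN x x0; rewrite normcM normc_cpow// normc_real !cReImE/=.
rewrite (le_trans (ler_wpM2r (powR_ge0 _ _) (normr_ln_le x a0)))//.
rewrite -mulrA [expR _ * _]mulrC.
rewrite (le_trans (ler_wpM2l _ (powR_expR_le_wt a0 az zN x0))) ?invr_ge0 ?(ltW a0)//.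
by apply: le_of_eq; ring.
Qed.

(** Factoring out x^(z-1) leaves e^w - 1 - w with w = h ln x, bounded by 4 |w|^2 e^|w|. Since |h| <=
    a/2, half of e^(a |ln x|) absorbs e^|w| and the other half absorbs (ln x)^2 at the cost (4/a)^2.
    This gives 64/a^2, and [powR_expR_le_wt] doubles it. *)
Lemma kernel_remainder z h a N : 0 < a -> 2 * a <= Re z -> Re z + a + 1 <= N%:R ->
  normc h <= a / 2 ->
  kernel_bound a N (128 / a ^+ 2 * normc h ^+ 2)
    (fun x => cpow x (z + h - 1) - cpow x (z - 1) - h * ((ln x)%:C * cpow x (z - 1))).
Proof.
move=> a0 az zN ha x x0.
rewrite (_ : _ - h * _ = cpow x (z - 1) * (cexp (h * (ln x)%:C) - 1 - h * (ln x)%:C)); last first.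
  rewrite !mulrBr mulr1 -cpow_cexp// -cpowD// [z - 1 + h]addrAC; congr (_ - _).
  by rewrite mulrA mulrC.
rewrite normcM normc_cpow// !cReImE /=.
set l : R := `|ln x|.
have H1 : normc (cexp (h * (ln x)%:C) - 1 - h * (ln x)%:C) <=
    64 / a ^+ 2 * normc h ^+ 2 * expR (a * l).
  rewrite (le_trans (cexp_remainder _))// normcM normc_real -/l.
  have l0 : 0 <= l by exact: normr_ge0.
  have h0 := normc_ge0 h.
  have e1 : expR (normc h * l) <= expR (a / 2 * l) by rewrite ler_expR ler_wpM2r.
  have e2 : l <= (a / 4)^-1 * expR (a / 4 * l) by apply: normr_ln_le; rewrite divr_gt0.
  have e3 : l ^+ 2 <= (a / 4)^-1 ^+ 2 * expR (a / 2 * l).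
    rewrite (_ : a / 2 * l = a / 4 * l + a / 4 * l); last by field.
    rewrite expRD expr2 (le_trans (ler_pM _ _ e2 e2))//.
    by apply: le_of_eq; ring.
  rewrite (_ : a * l = a / 2 * l + a / 2 * l); last by field.
  rewrite expRD exprMn.
  apply: (@le_trans _ _
    (4 * (normc h ^+ 2 * ((a / 4)^-1 ^+ 2 * expR (a / 2 * l))) * expR (a / 2 * l))).
    by rewrite ler_pM ?expR_ge0 ?mulr_ge0 ?sqr_ge0// ler_wpM2l// ler_wpM2l// sqr_ge0.
  by apply: le_of_eq; field; rewrite gt_eqF.
rewrite (le_trans (ler_wpM2l (powR_ge0 _ _) H1))// mulrCA.
rewrite (le_trans (ler_wpM2l _ (powR_expR_le_wt a0 az zN x0)))//.
  by rewrite mulr_ge0 ?sqr_ge0// divr_ge0 ?sqr_ge0.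
by apply: le_of_eq; field; rewrite gt_eqF.
Qed.

Lemma cmeasurable_ln : cmeasurable (`]0, +oo[%classic : set R) (fun x => (ln x)%:C).
Proof. by apply: cmeasurable_real; apply: measurable_oy => x; exact: continuous_ln. Qed.

(** The base inequality is 1 + x <= (1 + v)(1 + |u|), from x <= v + |u|. It trades the weight at x
    for the weight at u. *)
Lemma peetre x u v N : 0 <= x -> `|u - x| <= v ->
  (1 + x) ^+ N <= (1 + v) ^+ N * (1 + `|u|) ^+ N.
Proof.
move=> x0 uv; have v0 : 0 <= v by exact: le_trans uv.
rewrite -exprMn lerXn2r ?nnegrE ?mulr_ge0 ?addr_ge0//.
have : x <= v + `|u|.
  rewrite -[x]ger0_norm// -(subKr u x) (le_trans (ler_normB _ _))// addrC.
  by rewrite lerD2r.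
by have := mulr_ge0 v0 (normr_ge0 u); lra.
Qed.

Lemma expR_decay N : exists2 A, 0 <= A & forall x, 0 <= x -> (1 + x) ^+ N * expR (- x) <= A.
Proof.
(* The constant comes from the Taylor term (1 + x)^N / N! <= e^(1 + x). *)
exists (N`!%:R * expR 1); first by rewrite mulr_ge0 ?expR_ge0.
move=> x x0; rewrite expRN ler_pdivrMr ?expR_gt0// -mulrA -expRD.
have [->|] := eqVneq N 0%N.
  by rewrite expr0 fact0 mul1r -expR0 ler_expR addr_ge0.
rewrite -lt0n => /prednK <-.
have := @expR_ge1Dxn R (1 + x) N.-1.
rewrite addr_ge0// => /(_ isT); rewrite -ler_pdivrMl ?ltr0n ?fact_gt0//.
by apply: le_trans; rewrite mulrC lerDr.
Qed.

(** A remainder of size A |h|^2 leaves the difference quotient within A |h| of [d]. *)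
Lemma entire_at (F : C -> C) s d A r : 0 < r ->
  (forall h, normc h <= r -> normc (F (s + h) - F s - h * d) <= A * normc h ^+ 2) ->
  derivable (F : C^o -> C^o) s 1.
Proof.
move=> r0 H; apply/cvg_ex; exists d.
(* Taking h = r bounds a norm by A r^2, which forces the sign of [A]. *)
have A0 : 0 <= A.
  have := H (r%:C); rewrite normc_real (ger0_norm (ltW r0)) => /(_ (lexx _)).
  by move=> /(le_trans (normc_ge0 _)); rewrite pmulr_lge0// exprn_gt0.
apply/cvgrPdist_lt => e e0.
(* A positive element of the complex numbers is real, so the tolerance can be compared with real
   bounds. *)
have er : e = (Re e)%:C by rewrite RRe_real// gtr0_real.
have e0' : 0 < Re e by move: e0; rewrite {1}er ltcR.
pose q := Num.min r (Re e / (A + 1)).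
have q0 : 0 < q by rewrite lt_min r0 divr_gt0// ltr_wpDl.
have nE z : `|z| = (normc z)%:C by case: z.
exists q%:C; first by rewrite /= ltcR.
move=> h /=; rewrite sub0r normrN nE ltcR => hq h0.
have hr : normc h <= r by rewrite ltW// (lt_le_trans hq)// ge_min lexx.
have hn : 0 < normc h.
  by rewrite lt_neqAle normc_ge0 andbT eq_sym; apply: contra_neq h0 => /eq0_normc.
rewrite er nE ltcR.
rewrite (_ : d - _ = - (h^-1 * (F (s + h) - F s - h * d))); last first.
  rewrite /GRing.scale/= mulr1 [h + s]addrC.
  by field.
rewrite normcN normcM normcV mulrC ltr_pdivrMr//.
rewrite (le_lt_trans (H _ hr))// expr2 mulrA ltr_pM2r//.
rewrite (@le_lt_trans _ _ ((A + 1) * normc h))//; first by rewrite ler_pM2r// lerDl.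
by rewrite mulrC -ltr_pdivlMr ?ltr_wpDl// (lt_le_trans hq)// ge_min lexx orbT.
Qed.

End Estimates.

(** * The principal value *)

Section PrincipalValue.
Variable R : realType.
Local Notation C := (R[i]).
Local Notation Re := (@complex.Re R).
Local Notation Im := (@complex.Im R).
Local Notation mu := (@lebesgue_measure R).
Implicit Types (z w h : C) (x y a A K u v t e : R) (N : nat) (f g k : R -> C).

Lemma cintegrable_opp (D : set R) f : measurable D -> cmeasurable setT f ->
  cintegrable ((-%R : R -> R) @^-1` D) (f \o -%R) -> cintegrable D f.
Proof.
have mopp : measurable_fun setT (-%R : measurableTypeR R -> measurableTypeR R).
  exact: oppr_measurable.
move=> mD [f1 f2].
have H (q : R -> R) : measurable_fun setT q ->
    mu.-integrable ((-%R : R -> R) @^-1` D) (EFin \o (q \o -%R)) ->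
    mu.-integrable D (EFin \o q).
  move=> mq /integrableP[_ iq]; apply/integrableP; split.
    by apply/measurable_EFinP; apply: measurable_funTS.
  suff -> : (\int[mu]_(x in D) `|(EFin \o q) x| =
      \int[mu]_(x in (-%R : R -> R) @^-1` D) `|(EFin \o (q \o -%R)) x|)%E by [].
  rewrite -(@ge0_integral_pushforward _ _ (measurableTypeR R) (measurableTypeR R) R
    (-%R : R -> R) mopp mu D (fun x => `|(EFin \o q) x|%E))//.
    by apply: eq_measure_integral => B mB _; exact: lebesgue_measure_opp.
  by apply: measurableT_comp => //; apply/measurable_EFinP; apply: measurable_funTS.
by move=> [i1 i2]; split; apply: H.
Qed.

(** * The weight 1 / (e^(-t) - 1) *)

Lemma measurable_li0_weight : measurable_fun setT (fun t : R => (expR (- t) - 1)^-1).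
Proof.
(* The weight is continuous off 0, and any function is measurable on a single point. *)
rewrite -(setvU [set (0:R)]); apply/measurable_funU => //.
  exact: measurableC.
split; last exact: measurable_fun_set1.
apply: open_continuous_measurable_fun.
  by rewrite openC; exact: closed_eq.
move=> t; rewrite inE/= => /eqP t0.
apply: cvgV; first by rewrite subr_eq0 -expR0 (inj_eq (@expR_inj R)) oppr_eq0.
apply: cvgB; last exact: cvg_cst.
apply: (@continuous_comp _ _ _ (-%R : R -> R) expR); first exact: opp_continuous.
exact: continuous_expR.
Qed.

(** The weight is odd up to the constant -1. This constant produces the extra term -f(t) when the
    principal value is folded. *)
Lemma li0_weight_opp t : t != 0 -> (expR t - 1)^-1 = - 1 - (expR (- t) - 1)^-1.
Proof.
move=> t0.
have e0 : expR t != 0 by rewrite gt_eqF// expR_gt0.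
have e1 : expR t != 1 by rewrite -expR0 (inj_eq (@expR_inj R)).
rewrite expRN; field.
by rewrite e0/= mulN1r !subr_eq0 e1 andbT eq_sym.
Qed.

Lemma li0_weight_ge0 t : 0 < t -> 0 <= (expR t - 1)^-1.
Proof. by move=> t0; rewrite invr_ge0 subr_ge0 -expR0 ler_expR ltW. Qed.

(** Cross-multiplication reduces this to 1 + t <= e^t. The right side shows both the simple pole at
    0 and the exponential decay at infinity. *)
Lemma li0_weight_le t : 0 < t -> (expR t - 1)^-1 <= (1 + t) / t * expR (- t).
Proof.
move=> t0.
have e1 : 1 < expR t by rewrite -expR0 ltr_expR.
have t1 : 0 < 1 + t by rewrite addr_gt0.
rewrite -[leRHS]invrK lef_pV2 ?posrE ?subr_gt0 ?invr_gt0 ?mulr_gt0 ?expR_gt0 ?invr_gt0//.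
rewrite (_ : _^-1 = t * expR t / (1 + t)); last first.
  by rewrite expRN; field; rewrite !gt_eqF ?expR_gt0.
rewrite ler_pdivrMr//.
by have := expR_ge1Dx t; lra.
Qed.

Lemma normr_li0_weight_le t : 0 < t -> `|(expR (- t) - 1)^-1| <= (1 + t) / t.
Proof.
move=> t0.
have e1 : 1 < expR t by rewrite -expR0 ltr_expR.
have t1 : 0 < 1 + t by rewrite addr_gt0.
have := li0_weight_opp (_ : - t != 0); rewrite oppr_eq0 gt_eqF// opprK => /(_ isT) ->.
have b0 := li0_weight_ge0 t0.
have -> : - 1 - (expR t - 1)^-1 = - (1 + (expR t - 1)^-1) by rewrite opprD.
rewrite normrN ger0_norm ?addr_ge0//.
rewrite (_ : (1 + t) / t = 1 + t^-1); last by field; rewrite gt_eqF.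
rewrite lerD2l lef_pV2 ?posrE ?subr_gt0//.
by have := expR_ge1Dx t; lra.
Qed.

(** Each bound serves one region. As t -> -oo the weight decays exponentially and beats polynomial
    growth; as t -> +oo it tends to -1, so [f] itself must be integrable; near 0 the Lipschitz bound
    cancels the simple pole. One constant [K] governs all three, so estimates can be linear in
    it. *)
Definition pv_bound N K f :=
  [/\ forall t, normc (f t) <= K * (1 + `|t|) ^+ N,
      forall t, 0 <= t -> normc (f t) <= K * (1 + t) ^- 2
    & forall v t u, `|t| <= v -> `|u| <= v ->
        normc (f t - f u) <= K * (1 + v) ^+ N * `|t - u|].

Lemma pv_bound_ge0 N K f : pv_bound N K f -> 0 <= K.
Proof.
move=> [/(_ 0) + _ _]; rewrite normr0 addr0 expr1n mulr1.
by apply: le_trans; exact: normc_ge0.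
Qed.

Lemma pv_bound_cmeasurable N K f : pv_bound N K f -> cmeasurable setT f.
Proof.
move=> pf; have K0 := pv_bound_ge0 pf; have [_ _ f3] := pf.
(* Here [q] is the real or the imaginary part, whose composition with [f] is continuous because [f]
   is locally Lipschitz. *)
have H (q : C -> R) : (forall z w, q z - q w = q (z - w)) ->
    (forall z, `|q z| <= normc z) -> measurable_fun setT (q \o f).
  move=> qB qn; apply: continuous_measurable_fun => t.
  apply/cvgrPdist_lt => e e0.
  pose v := `|t| + 1; pose M := K * (1 + v) ^+ N.
  have v0 : 0 <= v by rewrite addr_ge0.
  have M0 : 0 <= M by rewrite mulr_ge0 ?exprn_ge0 ?addr_ge0.
  exists (Num.min 1 (e / (M + 1))) => /=.
    by rewrite lt_min ltr01/= divr_gt0// ltr_wpDl.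
  move=> u; rewrite /= lt_min => /andP[tu1 tu2].
  rewrite /= qB (le_lt_trans (qn _))//.
  rewrite (@le_lt_trans _ _ (M * `|t - u|))//.
    apply: f3; first by rewrite lerDl.
    by rewrite -(subKr t u) (le_trans (ler_normB _ _))// lerD2l ltW.
  rewrite (@le_lt_trans _ _ ((M + 1) * `|t - u|))//.
    by rewrite ler_wpM2r// lerDl.
  by rewrite mulrC -ltr_pdivlMr// ltr_wpDl.
split; apply: H => //.
- by move=> z w; rewrite !cReImE.
- exact: normc_ge_normRe.
- by move=> z w; rewrite !cReImE.
- exact: normc_ge_normIm.
Qed.

Lemma cmeasurable_li0_integrand f : cmeasurable setT f -> cmeasurable setT (li0_integrand f).
Proof.
move=> mf; apply: cmeasurableM => //.
exact: cmeasurable_real measurable_li0_weight.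
Qed.

(** The line folded at 0: in the sum the singularities at t and -t cancel to first order. *)
Definition li0_fold f : R -> C := fun t => li0_integrand f t + li0_integrand f (- t).

Lemma li0_foldE f t : 0 < t ->
  li0_fold f t = ((expR t - 1)^-1)%:C * (f (- t) - f t) - f t.
Proof.
move=> t0; rewrite /li0_fold /li0_integrand opprK.
have := li0_weight_opp (_ : - t != 0); rewrite oppr_eq0 gt_eqF// opprK => /(_ isT) ->.
rewrite !(rmorphB, rmorphN) rmorph1 mulrBr mulrBl mulN1r.
by rewrite addrC -addrA; congr (_ + _); rewrite addrC.
Qed.

(** The Lipschitz bound gives a factor 2t that cancels the pole of the weight, and the term -f(t)
    already decays. The constant depends on [N] only. *)
Lemma normc_li0_fold_le N : exists2 A, 0 <= A & forall K f, pv_bound N K f ->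
  forall t, 0 < t -> normc (li0_fold f t) <= A * K * (1 + t) ^- 2.
Proof.
(* The exponent collects N from the Lipschitz bound, 1 from the weight and 2 from the target (1 +
   t)^(-2); the summand 1 pays for -f(t). *)
have [A A0 HA] := @expR_decay R (N + 3); exists (2 * A + 1).
  by rewrite addr_ge0 ?mulr_ge0.
move=> K f pf t t0; have K0 := pv_bound_ge0 pf; have [_ f2 f3] := pf.
have t1 : 0 < 1 + t by rewrite addr_gt0.
rewrite li0_foldE// (le_trans (le_normcB _ _))// [2 * A + 1]addrC 2!mulrDl mul1r addrC.
rewrite lerD//; first exact/f2/ltW.
rewrite normcM normc_real ger0_norm ?li0_weight_ge0//.
have e1 : normc (f (- t) - f t) <= K * (1 + t) ^+ N * (2 * t).
  have := f3 t (- t) t; rewrite normrN (ger0_norm (ltW t0)) => /(_ (lexx _) (lexx _)).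
  rewrite (_ : - t - t = - (2 * t)); last by ring.
  by rewrite normrN (@ger0_norm _ (2 * t))// mulr_ge0// ltW.
rewrite (le_trans (ler_pM (li0_weight_ge0 t0) (normc_ge0 _) (li0_weight_le t0) e1))//.
have e2 := HA _ (ltW t0).
rewrite [leLHS](_ : _ = 2 * K * ((1 + t) ^+ (N + 3) * expR (- t)) * (1 + t) ^- 2); last first.
  by rewrite exprD; field; rewrite !gt_eqF.
rewrite ler_pM2r ?invr_gt0 ?exprn_gt0//.
rewrite (le_trans (ler_wpM2l _ e2)) ?mulr_ge0//.
by apply: le_of_eq; ring.
Qed.

Local Notation oo e := (`]e, +oo[%classic : set R).

Lemma measurable_oo e : measurable (oo e).
Proof. exact: measurable_itv. Qed.

Lemma integrable_pv A : mu.-integrable (oo 0) (EFin \o (fun t => A * (1 + t) ^- 2)).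
Proof.
apply: integrable_EFinZ; first exact: measurable_oo.
have -> : (fun t : R => (1 + t) ^- 2) = wt 1 by apply/funext => t; rewrite wt1.
exact: integrable_wt.
Qed.

Lemma sub_oo e : 0 < e -> oo e `<=` oo 0.
Proof. by move=> e0 t /=; rewrite !in_itv/= !andbT; apply: lt_trans. Qed.

Lemma integrable_pv_oo e A : 0 < e -> mu.-integrable (oo e) (EFin \o (fun t => A * (1 + t) ^- 2)).
Proof.
move=> e0; apply: (@integrableS _ (measurableTypeR R) R mu (oo 0) (oo e)) => //.
- exact: sub_oo.
- exact: integrable_pv.
Qed.

(** Beyond e the weight is at most 1 + 1/e in absolute value, so the decay of [f] alone ensures
    integrability. *)
Lemma pv_bound_cintegrable_r N K f e : pv_bound N K f -> 0 < e ->
  cintegrable (oo e) (li0_integrand f).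
Proof.
move=> pf e0; have [_ f2 _] := pf; have K0 := pv_bound_ge0 pf.
apply: (cintegrable_dominated _ _ (integrable_pv_oo ((1 + e^-1) * K) e0)).
- exact: measurable_oo.
- have [m1 m2] := cmeasurable_li0_integrand (pv_bound_cmeasurable pf).
  by split; apply: measurable_funTS.
- move=> t /=; rewrite in_itv/= andbT => te.
  have t0 : 0 < t by exact: lt_trans te.
  rewrite normcM normc_real -mulrA ler_pM ?normc_ge0//; last exact/f2/ltW.
  rewrite (le_trans (normr_li0_weight_le t0))//.
  rewrite mulrDl divff ?gt_eqF// mul1r addrC lerD2l.
  by rewrite lef_pV2 ?posrE// ltW.
Qed.

(** On the negative side [f] may grow, but there the weight is exponentially small. *)
Lemma pv_bound_cintegrable_l N K f e : pv_bound N K f -> 0 < e ->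
  cintegrable (oo e) (li0_integrand f \o -%R).
Proof.
move=> pf e0; have [f1 _ _] := pf; have K0 := pv_bound_ge0 pf.
have [A A0 HA] := @expR_decay R (N + 3).
apply: (cintegrable_dominated _ _ (integrable_pv_oo (e^-1 * A * K) e0)).
- exact: measurable_oo.
- apply: cmeasurable_comp; first exact: oppr_measurable.
  exact: (cmeasurable_li0_integrand (pv_bound_cmeasurable pf)).
- move=> t /=; rewrite in_itv/= andbT => te.
  have t0 : 0 < t by exact: lt_trans te.
  have t1 : 0 < 1 + t by rewrite addr_gt0.
  rewrite /li0_integrand opprK normcM normc_real ger0_norm ?li0_weight_ge0//.
  have := f1 (- t); rewrite normrN (ger0_norm (ltW t0)) => e1.
  rewrite (le_trans (ler_pM (li0_weight_ge0 t0) (normc_ge0 _) (li0_weight_le t0) e1))//.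
  rewrite [leLHS](_ : _ = t^-1 * ((1 + t) ^+ (N + 3) * expR (- t)) * K * (1 + t) ^- 2); last first.
    by rewrite exprD; field; rewrite !gt_eqF.
  rewrite ler_pM2r ?invr_gt0 ?exprn_gt0//.
  rewrite ler_wpM2r// ler_pM//.
  - by rewrite invr_ge0 ltW.
  - by rewrite mulr_ge0 ?expR_ge0 ?exprn_ge0 ?ltW.
  - by rewrite lef_pV2 ?posrE// ltW.
  - exact/HA/ltW.
Qed.

Lemma set_lt_normrE e : 0 < e ->
  [set t : R | e < `|t|] = (oo e) `|` (-%R : R -> R) @^-1` (oo e).
Proof.
move=> e0; apply/seteqP; split => t /=; rewrite !in_itv/= !andbT.
  by case: (leP 0 t) => t0; [rewrite ger0_norm//; left|rewrite ltr0_norm//; right].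
by case => te; rewrite (lt_le_trans te)// ?ler_norm// -normrN ler_norm.
Qed.

Lemma oppr_preimageK (D : set R) : (-%R : R -> R) @^-1` ((-%R : R -> R) @^-1` D) = D.
Proof. by apply/seteqP; split => t /=; rewrite opprK. Qed.

Lemma measurable_oppr_preimage e : measurable ((-%R : R -> R) @^-1` (oo e)).
Proof.
rewrite (_ : _ @^-1` _ = (`]-oo, - e[%classic : set R)); first exact: measurable_itv.
by apply/seteqP; split => t /=; rewrite !in_itv/= ?andbT ltrNr.
Qed.

Lemma cintegrable_setU (D D' : set R) f : measurable D -> measurable D' ->
  [disjoint D & D'] -> cintegrable D f -> cintegrable D' f -> cintegrable (D `|` D') f.
Proof.
move=> mD mD' DD.
have H (q : R -> R) : mu.-integrable D (EFin \o q) -> mu.-integrable D' (EFin \o q) ->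
    mu.-integrable (D `|` D') (EFin \o q).
  move=> /integrableP[m1 i1] /integrableP[m2 i2].
  have mU : measurable_fun (D `|` D') (EFin \o q) by apply/measurable_funU.
  apply/integrableP; split => //.
  rewrite ge0_integral_setU//; first by rewrite lte_add_pinfty.
  exact: measurableT_comp.
by move=> [i1 i2] [j1 j2]; split; apply: H.
Qed.

Lemma disjoint_oo_opp e : 0 < e -> [disjoint (oo e) & (-%R : R -> R) @^-1` (oo e)].
Proof.
move=> e0; apply/disj_setPS => t [/=]; rewrite !in_itv/= !andbT => t1 t2.
by lra.
Qed.

Lemma pv_bound_cintegrable_opp N K f e : pv_bound N K f -> 0 < e ->
  cintegrable ((-%R : R -> R) @^-1` (oo e)) (li0_integrand f).
Proof.
move=> pf e0.
have mf := cmeasurable_li0_integrand (pv_bound_cmeasurable pf).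
apply: cintegrable_opp => //; first exact: measurable_oppr_preimage.
by rewrite oppr_preimageK; exact: (pv_bound_cintegrable_l pf e0).
Qed.

Lemma pv_bound_cintegrable N K f e : pv_bound N K f -> 0 < e ->
  cintegrable [set t | e < `|t|] (li0_integrand f).
Proof.
move=> pf e0; rewrite set_lt_normrE//.
apply: cintegrable_setU.
- exact: measurable_oo.
- exact: measurable_oppr_preimage.
- exact: disjoint_oo_opp.
- exact: (pv_bound_cintegrable_r pf e0).
- exact: (pv_bound_cintegrable_opp pf e0).
Qed.

Lemma li0_truncatedE N K f e : pv_bound N K f -> 0 < e ->
  li0_truncated f e = cintegral (oo e) (li0_fold f).
Proof.
move=> pf e0; rewrite /li0_truncated set_lt_normrE//.
have i1 := pv_bound_cintegrable_r pf e0.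
have i2 := pv_bound_cintegrable_opp pf e0.
have i3 := pv_bound_cintegrable_l pf e0.
have mf := cmeasurable_li0_integrand (pv_bound_cmeasurable pf).
have mo := measurable_oo e.
have mp := measurable_oppr_preimage e.
have dd := disjoint_oo_opp e0.
rewrite cintegral_setU//; last exact: cintegrable_setU.
rewrite (cintegral_opp mp mf) oppr_preimageK//.
by rewrite -cintegralD.
Qed.

Lemma pv_bound_cmeasurable_fold (D : set R) N K f : pv_bound N K f ->
  cmeasurable D (li0_fold f).
Proof.
move=> pf; have [m1 m2] := cmeasurable_li0_integrand (pv_bound_cmeasurable pf).
apply: cmeasurableD; first by split; apply: measurable_funTS.
by apply: (@cmeasurable_comp _ (li0_integrand f) -%R) => //; exact: oppr_measurable.
Qed.

Lemma cintegrable_li0_fold N K f : pv_bound N K f -> cintegrable (oo 0) (li0_fold f).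
Proof.
move=> pf; have [A A0 HA] := normc_li0_fold_le N.
apply: (cintegrable_dominated _ _ (integrable_pv (A * K))).
- exact: measurable_oo.
- exact: pv_bound_cmeasurable_fold pf.
- by move=> t; rewrite /= in_itv/= andbT => t0; exact: (HA _ _ pf).
Qed.

Lemma normc_cE z : `|z : C^o| = (normc z)%:C.
Proof. by case: z. Qed.

(** The folded integrand is bounded near 0, so the missing piece over []0, e]] is O(e). *)
Lemma li0_truncated_cvg N K f : pv_bound N K f ->
  li0_truncated f e @[e --> 0^'+] --> (cintegral (oo 0) (li0_fold f) : C^o).
Proof.
move=> pf; have [A A0 HA] := normc_li0_fold_le N.
have K0 := pv_bound_ge0 pf.
have i0 := cintegrable_li0_fold pf.
pose M := A * K; have M0 : 0 <= M by rewrite mulr_ge0.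
apply/cvgrPdist_lt => eps eps0.
have er : eps = (Re eps)%:C by rewrite RRe_real// gtr0_real.
have e0' : 0 < Re eps by move: eps0; rewrite {1}er ltcR.
(* The 2 is the loss in [normc_cintegral_le]; the added 1 keeps the denominator positive. *)
exists (Re eps / (2 * M + 1)) => /=.
  by rewrite divr_gt0// ltr_wpDl// mulr_ge0.
move=> e /=; rewrite sub0r normrN => + e0; rewrite gtr0_norm// => ee.
rewrite (li0_truncatedE pf e0) normc_cE er ltcR.
have E : oo 0 = (`]0, e]%classic : set R) `|` oo e.
  apply/seteqP; split => t /=; rewrite !in_itv/= !andbT.
    by move=> t0; case: (leP t e) => te; [left; rewrite t0|right].
  by case => [/andP[]//|]; exact: lt_trans.
have me : measurable (`]0, e]%classic : set R) by exact: measurable_itv.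
have dd : [disjoint (`]0, e]%classic : set R) & oo e].
  apply/disj_setPS => t [/=]; rewrite !in_itv/= andbT => /andP[_ te] et.
  by move: (lt_le_trans et te); rewrite ltxx.
rewrite E cintegral_setU//; last by rewrite -E.
rewrite addrK.
have ic : mu.-integrable (`]0, e]%classic : set R) (EFin \o (fun=> M)).
  apply/integrableP; split; first exact: measurable_cst.
  rewrite /= integral_cst//= lebesgue_measure_itv/= lte_fin e0.
  by rewrite -EFinB -EFinM ltry.
have mm := pv_bound_cmeasurable_fold (`]0, e]%classic : set R) pf.
have bd t : (`]0, e]%classic : set R) t -> normc (li0_fold f t) <= M.
  rewrite /= in_itv/= => /andP[t0 _]; rewrite (le_trans (HA _ _ pf _ t0))//.
  rewrite ler_piMr// invf_le1 ?exprn_gt0 ?addr_gt0//.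
  by rewrite exprn_ege1// lerDl ltW.
rewrite (le_lt_trans (normc_cintegral_le me mm ic bd))//.
rewrite Rintegral_cst//= lebesgue_measure_itv/= lte_fin e0 -EFinB /= subr0.
rewrite mulrA (@le_lt_trans _ _ ((2 * M + 1) * e))//.
  by rewrite ler_wpM2r ?lerDl// ltW.
by rewrite mulrC -ltr_pdivlMr// ltr_wpDl// mulr_ge0.
Qed.

Lemma pv_bound_well_defined N K f : pv_bound N K f -> li0_well_defined f.
Proof.
move=> pf; split; first by move=> e; exact: (pv_bound_cintegrable pf).
by apply/cvg_ex; exists (cintegral (oo 0) (li0_fold f)); exact: (li0_truncated_cvg pf).
Qed.

Lemma li0E N K f : pv_bound N K f -> li0 f = cintegral (oo 0) (li0_fold f).
Proof. by move=> /li0_truncated_cvg /cvg_lim; apply. Qed.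

(** The constant does not depend on [f]. This uniformity yields both continuity in the test function
    and boundedness in the kernel. *)
Lemma normc_li0_le N : exists2 A, 0 <= A & forall K f, pv_bound N K f ->
  normc (li0 f) <= A * K.
Proof.
have [A A0 HA] := normc_li0_fold_le N; exists (2 * A); first by rewrite mulr_ge0.
move=> K f pf; rewrite (li0E pf).
have m0 := measurable_oo 0.
have mm := pv_bound_cmeasurable_fold (oo 0) pf.
rewrite (le_trans (normc_cintegral_le m0 mm (integrable_pv (A * K)) _))//.
  by move=> t; rewrite /= in_itv/= andbT => t0; exact: (HA _ _ pf).
have -> : (fun t : R => A * K * (1 + t) ^- 2) = (fun t => A * K * wt 1 t).
  by apply/funext => t; rewrite wt1.
rewrite RintegralZl//; last exact: integrable_wt.
by rewrite Rintegral_wt// invr1 mulr1 mulrA.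
Qed.

Lemma pv_bound_linear z N K f K' g : pv_bound N K f -> pv_bound N K' g ->
  pv_bound N (normc z * K + K') (fun t => z * f t + g t).
Proof.
move=> [f1 f2 f3] [g1 g2 g3]; have nz := normc_ge0 z; split.
- move=> t; rewrite (le_trans (le_normcD _ _))// normcM mulrDl lerD// -mulrA.
  by rewrite ler_wpM2l.
- move=> t t0; rewrite (le_trans (le_normcD _ _))// normcM mulrDl lerD ?g2// -mulrA.
  by rewrite ler_wpM2l// f2.
- move=> v t u tv uv.
  rewrite (_ : _ - _ = z * (f t - f u) + (g t - g u)); last by rewrite mulrBr opprD addrACA.
  rewrite (le_trans (le_normcD _ _))// normcM !mulrDl lerD ?g3// -!mulrA.
  by rewrite ler_wpM2l// mulrA f3.
Qed.

Lemma li0_linear z N K f K' g : pv_bound N K f -> pv_bound N K' g ->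
  li0 (fun t => z * f t + g t) = z * li0 f + li0 g.
Proof.
move=> pf pg; rewrite (li0E (pv_bound_linear z pf pg)) (li0E pf) (li0E pg).
rewrite -cintegral_linear; first last.
- exact: (cintegrable_li0_fold pg).
- exact: (cintegrable_li0_fold pf).
- exact: measurable_oo.
apply: eq_cintegral => t _; rewrite /li0_fold /li0_integrand.
by rewrite !mulrDr !(mulrCA z) addrACA.
Qed.

Lemma pv_boundZ z N K f : pv_bound N K f ->
  pv_bound N (normc z * K) (fun t => z * f t).
Proof.
move=> [f1 f2 f3]; have nz := normc_ge0 z; split.
- by move=> t; rewrite normcM -mulrA ler_wpM2l.
- by move=> t t0; rewrite normcM -mulrA ler_wpM2l// f2.
- by move=> v t u tv uv; rewrite -mulrBr normcM -!mulrA ler_wpM2l// mulrA f3.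
Qed.

Lemma li0Z z N K f : pv_bound N K f -> li0 (fun t => z * f t) = z * li0 f.
Proof.
move=> pf; rewrite (li0E (pv_boundZ z pf)) (li0E pf).
rewrite -cintegralZ; [|exact: measurable_oo|exact: (cintegrable_li0_fold pf)].
apply: eq_cintegral => t _; rewrite /li0_fold /li0_integrand.
by rewrite mulrDr !(mulrCA z).
Qed.

End PrincipalValue.

(** * Convolution with kernels on the half-line *)

Section Convolution.
Variable R : realType.
Local Notation C := (R[i]).
Local Notation Re := (@complex.Re R).
Local Notation Im := (@complex.Im R).
Local Notation mu := (@lebesgue_measure R).
Local Notation oo := (`]0, +oo[%classic : set R).
Implicit Types (z w h : C) (x y a b A K u v t e P : R) (N M : nat) (f g k : R -> C).

Definition kernel a N A k :=
  [/\ 0 <= A, cmeasurable oo k & kernel_bound a N A k].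

Definition decay M P g := forall u, normc (g u) * (1 + `|u|) ^+ M <= P.

Definition cderivative g g' :=
  (forall u, is_derive u 1 (Re \o g) (Re (g' u))) /\
  (forall u, is_derive u 1 (Im \o g) (Im (g' u))).

(** The pairing of [k] with the translate of [g] by t, that is, the convolution of [g] with the
    reflected kernel. *)
Definition conv k g t : C := cintegral oo (fun x => k x * g (x + t)).

Lemma measurable_oo0 : measurable oo. Proof. exact: measurable_itv. Qed.

Lemma kernel_linear z a N A1 A2 k1 k2 : kernel a N A1 k1 -> kernel a N A2 k2 ->
  kernel a N (normc z * A1 + A2) (fun x => z * k1 x + k2 x).
Proof.
move=> [A10 m1 b1] [A20 m2 b2]; split.
- by rewrite addr_ge0 ?mulr_ge0 ?normc_ge0.
- by apply: cmeasurableD => //; apply: cmeasurableM => //; exact: cmeasurable_cst.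
- move=> x x0; rewrite (le_trans (le_normcD _ _))// normcM mulrDl lerD ?b2//.
  by rewrite -mulrA ler_wpM2l ?normc_ge0// b1.
Qed.

Section kernel_integral.
Variables (a A b : R) (N : nat) (k q : R -> C).
Hypotheses (a0 : 0 < a) (kk : kernel a N A k) (mq : cmeasurable oo q).
Hypothesis qb : forall x, 0 < x -> normc (q x) * (1 + x) ^+ N <= b.

(** The factor (1 + x)^N passes from the kernel to [q], and the integrable [wt a] remains. *)
Lemma kernel_dominated x : 0 < x -> normc (k x * q x) <= A * b * wt a x.
Proof.
move=> x0; have [A0 _ /(_ _ x0) kx] := kk; rewrite normcM.
rewrite (le_trans (ler_wpM2r (normc_ge0 _) kx))//.
rewrite [leLHS](_ : _ = A * wt a x * (normc (q x) * (1 + x) ^+ N)); last by ring.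
rewrite (_ : A * b * _ = A * wt a x * b); last by ring.
by apply: ler_wpM2l; [rewrite mulr_ge0 ?wt_ge0|exact: qb].
Qed.

Let mkq : cmeasurable oo (fun x => k x * q x).
Proof. by have [_ mk _] := kk; exact: cmeasurableM. Qed.

Let iw : mu.-integrable oo (EFin \o (fun x => A * b * wt a x)).
Proof. by apply: integrable_EFinZ; [exact: measurable_oo0|exact: integrable_wt]. Qed.

Lemma kernel_cintegrable : cintegrable oo (fun x => k x * q x).
Proof.
apply: (cintegrable_dominated measurable_oo0 mkq iw) => x.
by rewrite /= in_itv/= andbT; exact: kernel_dominated.
Qed.

Lemma kernel_cintegral_le : normc (cintegral oo (fun x => k x * q x)) <= 2 * (A * b / a).
Proof.
apply: (le_trans (normc_cintegral_le measurable_oo0 mkq iw _)) => [x|].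
  by rewrite /= in_itv/= andbT; exact: kernel_dominated.
by rewrite RintegralZl ?Rintegral_wt//; exact: integrable_wt.
Qed.

End kernel_integral.

Lemma decay_ge0 M P g : decay M P g -> 0 <= P.
Proof.
by move=> /(_ 0); apply: le_trans; rewrite mulr_ge0 ?normc_ge0 ?exprn_ge0 ?addr_ge0.
Qed.

Lemma decayW M N P g : (M <= N)%N -> decay N P g -> decay M P g.
Proof.
move=> MN gN u; apply: le_trans (gN u); rewrite ler_wpM2l ?normc_ge0//.
by rewrite ler_weXn2l// lerDl.
Qed.

Lemma decay_peetre N P g x u v : decay N P g -> 0 <= x -> `|u - x| <= v ->
  normc (g u) * (1 + x) ^+ N <= P * (1 + v) ^+ N.
Proof.
move=> gN x0 uv; have v0 : 0 <= v := le_trans (normr_ge0 _) uv.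
rewrite (le_trans (ler_wpM2l (normc_ge0 _) (peetre N x0 uv)))// mulrCA mulrC.
by rewrite ler_wpM2r ?gN// exprn_ge0// addr_ge0.
Qed.

Lemma cderivative_continuous g g' : cderivative g g' ->
  continuous (Re \o g) /\ continuous (Im \o g).
Proof.
by move=> [d1 d2]; split => u; [exact: derive_continuous (d1 u)|exact: derive_continuous (d2 u)].
Qed.

Lemma cderivative_measurable g g' : cderivative g g' -> cmeasurable setT g.
Proof.
by move=> /cderivative_continuous[c1 c2]; split; exact: continuous_measurable_fun.
Qed.

Lemma cmeasurable_shift g g' t : cderivative g g' -> cmeasurable oo (fun x => g (x + t)).
Proof.
move=> /cderivative_measurable mg.
apply: (@cmeasurable_comp _ g (fun x => x + t)) => //.
by apply: measurable_funD; [exact: measurable_id|exact: measurable_cst].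
Qed.

Section conv.
Variables (a A P : R) (N : nat) (k g g' : R -> C).
Hypotheses (a0 : 0 < a) (kk : kernel a N A k) (dg : cderivative g g').
Hypotheses (gP : decay (N + 2) P g) (gP' : decay (N + 2) P g').

Let P0 : 0 <= P. Proof. exact: decay_ge0 gP. Qed.
Let A0 : 0 <= A. Proof. by case: kk. Qed.

Lemma conv_bound v t x : `|t| <= v -> 0 < x ->
  normc (g (x + t)) * (1 + x) ^+ N <= P * (1 + v) ^+ N.
Proof.
move=> tv x0; apply: decay_peetre => //; last by rewrite addrAC subrr add0r.
- by apply: decayW gP; rewrite leq_addr.
- exact: ltW.
Qed.

Lemma conv_cintegrable t : cintegrable oo (fun x => k x * g (x + t)).
Proof.
apply: (kernel_cintegrable a0 kk (cmeasurable_shift t dg)) => x.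
exact: conv_bound.
Qed.

(** Peetre's inequality gives the growth bound. For t >= 0 the number 1 + x + t exceeds both 1 + x
    and 1 + t, so of the N + 2 powers of decay N pay for the kernel and 2 give (1 + t)^(-2). The
    decay of [g'] gives the Lipschitz bound. *)
Lemma conv_pv_bound : pv_bound N (4 * (A * P / a)) (conv k g).
Proof.
have APa : 0 <= A * P / a by rewrite divr_ge0 ?mulr_ge0// ltW.
split.
- move=> t.
  have := kernel_cintegral_le a0 kk (cmeasurable_shift t dg) (fun x => @conv_bound _ t x (lexx _)).
  move=> /le_trans; apply.
  rewrite (_ : A * _ / a = A * P / a * (1 + `|t|) ^+ N); last by ring.
  rewrite mulrA ler_wpM2r ?exprn_ge0 ?addr_ge0// ler_wpM2r//.
  by rewrite ler_nat.
- move=> t t0.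
  have t1 : 0 < 1 + t by rewrite ltr_wpDr.
  have H x : 0 < x -> normc (g (x + t)) * (1 + x) ^+ N <= P * (1 + t) ^- 2.
    move=> x0; rewrite ler_pdivlMr ?exprn_gt0//.
    apply: le_trans (gP (x + t)); rewrite -mulrA ler_wpM2l ?normc_ge0// exprD.
    rewrite ger0_norm ?addr_ge0 ?(ltW x0)//.
    by rewrite ler_pM ?exprn_ge0 ?lerXn2r ?nnegrE ?addr_ge0 ?(ltW x0)//
      ?lerD2l ?lerDl ?lerDr ?(ltW x0).
  have := kernel_cintegral_le a0 kk (cmeasurable_shift t dg) H.
  move=> /le_trans; apply.
  rewrite (_ : A * _ / a = A * P / a * (1 + t) ^- 2); last by ring.
  rewrite mulrA ler_wpM2r ?invr_ge0 ?exprn_ge0 ?(ltW t1)// ler_wpM2r//.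
  by rewrite ler_nat.
- move=> v t u tv uv.
  have v0 : 0 <= v := le_trans (normr_ge0 _) tv.
  rewrite /conv -cintegralB; first last.
  - exact: conv_cintegrable.
  - exact: conv_cintegrable.
  - exact: measurable_oo0.
  rewrite (_ : cintegral oo _ = cintegral oo (fun x => k x * (g (x + t) - g (x + u)))); last first.
    by apply: eq_cintegral => x _; rewrite mulrBr.
  (* The mean value theorem applies to real functions only, so it is used on both parts. This costs
     a factor 2 and, with the 2 of [kernel_cintegral_le], accounts for the 4 in the statement. *)
  have H x : 0 < x -> normc (g (x + t) - g (x + u)) * (1 + x) ^+ N <=
      2 * (P * (1 + v) ^+ N * `|t - u|).
    move=> x0; have x1 : 0 < (1 + x) ^+ N by rewrite exprn_gt0// addr_gt0.
    rewrite -ler_pdivlMr//.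
    have Q (q : C -> R) : (forall z, `|q z| <= normc z) ->
        (forall y, is_derive y 1 (q \o g) (q (g' y))) ->
        `|q (g (x + t)) - q (g (x + u))| <= P * (1 + v) ^+ N / (1 + x) ^+ N * `|t - u|.
      move=> qn dq.
      rewrite (_ : t - u = (x + t) - (x + u)); last by ring.
      apply: (derive_bound dq) => y yb; rewrite (le_trans (qn _))// ler_pdivlMr//.
      apply: decay_peetre; [|exact: ltW|].
        by apply: decayW gP'; rewrite leq_addr.
      move: tv uv; rewrite !ler_norml => /andP[tv1 tv2] /andP[uv1 uv2].
      by move: yb; case: (leP (x + u) (x + t)) => _ /andP[y1 y2]; apply/andP; split; lra.
    rewrite (le_trans (normc_le_ReIm _))// !cReImE.
    rewrite (_ : 2 * _ / _ = P * (1 + v) ^+ N / (1 + x) ^+ N * `|t - u| +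
      P * (1 + v) ^+ N / (1 + x) ^+ N * `|t - u|); last by ring.
    apply: lerD.
      by apply: (Q Re) => [z|y]; [exact: normc_ge_normRe|case: dg].
    by apply: (Q Im) => [z|y]; [exact: normc_ge_normIm|case: dg].
  have := kernel_cintegral_le a0 kk
    (cmeasurableB (cmeasurable_shift t dg) (cmeasurable_shift u dg)) H.
  move=> /le_trans; apply.
  by apply: le_of_eq; ring.
Qed.

End conv.

(** * Holomorphic dependence on the exponent *)

Lemma kernel_mellin z a N : 0 < a -> a <= Re z -> Re z + 1 <= N%:R ->
  kernel a N 1 (fun x => cpow x (z - 1)).
Proof.
by move=> a0 az zN; split => //; [exact: cmeasurable_cpow|exact: kernel_cpow].
Qed.

Lemma kernel_mellin_log z a N : 0 < a -> 2 * a <= Re z -> Re z + a + 1 <= N%:R ->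
  kernel a N (2 / a) (fun x => (ln x)%:C * cpow x (z - 1)).
Proof.
move=> a0 az zN; split; [by rewrite divr_ge0// ltW| |exact: kernel_log].
by apply: cmeasurableM; [exact: cmeasurable_ln|exact: cmeasurable_cpow].
Qed.

(* A functional on kernels which is linear and bounded depends holomorphically
   on [z] along the kernels [x ^ (z - 1)]: the remainder of order one is the
   image of a kernel of size [O(|h| ^ 2)]. *)
Lemma mellin_derivable (L : (R -> C) -> C) z a N K : 0 < a -> 0 <= K ->
  2 * a <= Re z -> Re z + a + 1 <= N%:R ->
  (forall w A1 A2 k1 k2, kernel a N A1 k1 -> kernel a N A2 k2 ->
     L (fun x => w * k1 x + k2 x) = w * L k1 + L k2) ->
  (forall A k, kernel a N A k -> normc (L k) <= K * A) ->
  derivable ((fun w => L (fun x => cpow x (w - 1))) : C^o -> C^o) z 1.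
Proof.
move=> a0 K0 az zN Ll Lb.
pose k0 w := (fun x => cpow x (w - 1)) : R -> C.
pose k1 := (fun x => (ln x)%:C * cpow x (z - 1)) : R -> C.
apply: (@entire_at R _ z (L k1) (K * (128 / a ^+ 2)) (a / 2)); first by rewrite divr_gt0.
move=> h ha; have /ler_normlP[hn hp] := le_trans (normc_ge_normRe h) ha.
have kz : kernel a N 1 (k0 z) by apply: kernel_mellin => //; lra.
have kzh : kernel a N 1 (k0 (z + h)) by apply: kernel_mellin => //; rewrite !cReImE; lra.
have kl : kernel a N (2 / a) k1 by exact: kernel_mellin_log.
have ks := kernel_linear (-1) kz kzh.
(* Linearity is available only in the form w k1 + k2 for admissible kernels, so the remainder is
   assembled in two such steps. *)
have E1 : L (fun x => - h * k1 x + (-1 * k0 z x + k0 (z + h) x)) =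
    L (k0 (z + h)) - L (k0 z) - h * L k1.
  by rewrite (Ll _ _ _ _ _ kl ks) (Ll _ _ _ _ _ kz kzh); rewrite mulN1r mulNr addrC (addrC (- L _)).
rewrite -E1 -mulrA; apply: Lb; split.
- by rewrite mulr_ge0 ?sqr_ge0// divr_ge0 ?sqr_ge0.
- by have [_ ? _] := kernel_linear (- h) kl ks.
- move=> x x0; rewrite [X in normc X](_ : _ =
    cpow x (z + h - 1) - cpow x (z - 1) - h * ((ln x)%:C * cpow x (z - 1))).
    exact: kernel_remainder.
  by rewrite mulN1r mulNr addrC (addrC (- k0 z x)).
Qed.

Lemma conv_linear_l z a N A1 A2 P k1 k2 g g' t : 0 < a ->
  kernel a N A1 k1 -> kernel a N A2 k2 -> cderivative g g' -> decay (N + 2) P g ->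
  conv (fun x => z * k1 x + k2 x) g t = z * conv k1 g t + conv k2 g t.
Proof.
move=> a0 kk1 kk2 dg gP; rewrite /conv -cintegral_linear; first last.
- exact: (conv_cintegrable a0 kk2 dg gP).
- exact: (conv_cintegrable a0 kk1 dg gP).
- exact: measurable_oo0.
by apply: eq_cintegral => x _; rewrite mulrDl mulrA.
Qed.

Lemma conv_linear_r z a N A P1 P2 k g1 g1' g2 g2' t : 0 < a ->
  kernel a N A k -> cderivative g1 g1' -> decay (N + 2) P1 g1 ->
  cderivative g2 g2' -> decay (N + 2) P2 g2 ->
  conv k (fun u => z * g1 u + g2 u) t = z * conv k g1 t + conv k g2 t.
Proof.
move=> a0 kk dg1 gP1 dg2 gP2; rewrite /conv -cintegral_linear; first last.
- exact: (conv_cintegrable a0 kk dg2 gP2).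
- exact: (conv_cintegrable a0 kk dg1 gP1).
- exact: measurable_oo0.
by apply: eq_cintegral => x _; rewrite mulrDr mulrCA.
Qed.

(** The slack [a] leaves room for perturbations: for |h| <= a/2 the exponent z + h still satisfies a
    <= Re (z + h) and Re (z + h) + 1 <= N. *)
Lemma mellin_order z : 0 < Re z ->
  exists a N, [/\ 0 < a, 2 * a <= Re z & Re z + a + 1 <= N%:R].
Proof.
move=> z0; exists (Re z / 2), (Num.truncn (Re z + Re z / 2 + 1)).+1; split.
- by rewrite divr_gt0.
- by rewrite mulrC divfK.
- by apply/ltW; rewrite truncnS_gt.
Qed.

(** The map from a kernel [k] to [li0 (conv k g)] is linear and, by [conv_pv_bound] and
    [normc_li0_le], bounded, so [mellin_derivable] applies. *)
Lemma li0_conv_derivable z g g' : 0 < Re z -> cderivative g g' ->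
  (forall M, exists P, decay M P g) -> (forall M, exists P, decay M P g') ->
  derivable ((fun w => li0 (conv (fun x => cpow x (w - 1)) g)) : C^o -> C^o) z 1.
Proof.
move=> z0 dg gd gd'; have [a [N [a0 az zN]]] := mellin_order z0.
have [P1 gP1] := gd (N + 2)%N; have [P2 gP2] := gd' (N + 2)%N.
pose P := Num.max P1 P2.
have gP : decay (N + 2) P g by move=> u; rewrite le_max gP1.
have gP' : decay (N + 2) P g' by move=> u; rewrite le_max gP2 orbT.
have P0 : 0 <= P by exact: decay_ge0 gP.
have [B B0 HB] := @normc_li0_le R N.
apply: (@mellin_derivable (fun k => li0 (conv k g)) z a N (B * (4 * (P / a)))) => //.
- by rewrite mulr_ge0// mulr_ge0// divr_ge0// ltW.
- move=> w A1 A2 k1 k2 kk1 kk2.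
  rewrite -(li0_linear w (conv_pv_bound a0 kk1 dg gP gP') (conv_pv_bound a0 kk2 dg gP gP')).
  congr li0; apply/funext => t; exact: (conv_linear_l w t a0 kk1 kk2 dg gP).
- move=> A k kk; rewrite (le_trans (HB _ _ (conv_pv_bound a0 kk dg gP gP')))//.
  by apply: le_of_eq; ring.
Qed.

End Convolution.

(** * Integration by parts and the Gamma function *)

Section Gamma.
Variable R : realType.
Local Notation C := (R[i]).
Local Notation Re := (@complex.Re R).
Local Notation Im := (@complex.Im R).
Local Notation mu := (@lebesgue_measure R).
Local Notation oo := (`]0, +oo[%classic : set R).
Implicit Types (z w : C) (x y a A M t : R) (N : nat) (F D g : R -> C).

Definition oy_derivative F D := forall x, 0 < x ->
  is_derive x 1 (Re \o F) (Re (D x)) /\ is_derive x 1 (Im \o F) (Im (D x)).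

Definition oy_continuous D := forall x, 0 < x ->
  {for x, continuous (Re \o D)} /\ {for x, continuous (Im \o D)}.

Lemma oy_derivative_continuous F D : oy_derivative F D -> oy_continuous F.
Proof.
by move=> d x /d[d1 d2]; split; [exact: derive_continuous d1|exact: derive_continuous d2].
Qed.

Lemma oy_derivativeM F D F' D' : oy_derivative F D -> oy_derivative F' D' ->
  oy_derivative (fun x => F x * F' x) (fun x => D x * F' x + F x * D' x).
Proof.
move=> d d' x x0; have [d1 d2] := d _ x0; have [d1' d2'] := d' _ x0; split.
  rewrite (_ : _ \o _ = (Re \o F) * (Re \o F') - (Im \o F) * (Im \o F')); last first.
    by apply/funext => y /=; rewrite cReM.
  apply: (is_derive_eq (is_deriveB (is_deriveM d1 d1') (is_deriveM d2 d2'))).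
  by rewrite /GRing.scale/= !cReImE; ring.
rewrite (_ : _ \o _ = (Re \o F) * (Im \o F') + (Im \o F) * (Re \o F')); last first.
  by apply/funext => y /=; rewrite cImM.
apply: (is_derive_eq (is_deriveD (is_deriveM d1 d2') (is_deriveM d2 d1'))).
by rewrite /GRing.scale/= !cReImE; ring.
Qed.

Lemma oy_continuousM F D : oy_continuous F -> oy_continuous D ->
  oy_continuous (fun x => F x * D x).
Proof.
move=> c d x x0; have [c1 c2] := c _ x0; have [d1 d2] := d _ x0; split.
  rewrite (_ : _ \o _ = (Re \o F) \* (Re \o D) \- (Im \o F) \* (Im \o D)).
    by apply: cvgB; apply: cvgM.
  by apply/funext => y /=; rewrite cReM.
rewrite (_ : _ \o _ = (Re \o F) \* (Im \o D) \+ (Im \o F) \* (Re \o D)).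
  by apply: cvgD; apply: cvgM.
by apply/funext => y /=; rewrite cImM.
Qed.

Lemma oy_continuousD F D : oy_continuous F -> oy_continuous D ->
  oy_continuous (fun x => F x + D x).
Proof.
move=> c d x x0; have [c1 c2] := c _ x0; have [d1 d2] := d _ x0; split.
  rewrite (_ : _ \o _ = (Re \o F) \+ (Re \o D)); first exact: cvgD.
  by apply/funext => y /=; rewrite cReD.
rewrite (_ : _ \o _ = (Im \o F) \+ (Im \o D)); first exact: cvgD.
by apply/funext => y /=; rewrite cImD.
Qed.

Lemma oy_continuous_cst z : oy_continuous (fun=> z).
Proof. by move=> x x0; split; exact: cvg_cst. Qed.

Lemma oy_derivative_cpow z : oy_derivative (fun x => cpow x z) (fun x => z * cpow x (z - 1)).
Proof. by move=> x x0; exact: is_derive_cpow. Qed.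

(** Squeezed by [b], the primitive [F] vanishes at both ends and leaves no boundary term. *)
Lemma cintegral_derivative0 F D a A (b : R -> R) : 0 < a -> 0 <= A ->
  oy_derivative F D -> oy_continuous D ->
  (forall x, 0 < x -> normc (D x) <= A * wt a x) ->
  (forall x, 0 < x -> normc (F x) <= b x) ->
  b x @[x --> 0^'+] --> 0 -> b x @[x --> +oo] --> 0 ->
  cintegral oo D = 0.
Proof.
move=> a0 A0 dF cD DA Fb b0 b1.
have H (q : C -> R) : (forall z, `|q z| <= normc z) ->
    (forall x, 0 < x -> is_derive x 1 (q \o F) (q (D x))) ->
    (forall x, 0 < x -> {for x, continuous (q \o D)}) ->
    Rintegral mu oo (q \o D) = 0.
  move=> qn dq cq; rewrite -[RHS](subrr 0).
  apply: (@dominated_FTC_oy R (q \o D) (q \o F) 0 0 a A) => //.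
  - by move=> x x0; rewrite (le_trans (qn _))// DA.
  - apply/norm_cvg0P; apply: (@squeeze_cvgr _ _ _ _ (fun=> 0) b) => //; last exact: cvg_cst.
    near=> x; rewrite normr_ge0/= (le_trans (qn _))// Fb//.
  - apply/norm_cvg0P; apply: (@squeeze_cvgr _ _ _ _ (fun=> 0) b) => //; last exact: cvg_cst.
    near=> x; rewrite normr_ge0/= (le_trans (qn _))// Fb//.
apply: complex_ext; rewrite /cintegral /=; apply: H.
- exact: normc_ge_normRe.
- by move=> x /dF[].
- by move=> x /cD[].
- exact: normc_ge_normIm.
- by move=> x /dF[].
- by move=> x /cD[].
Unshelve. all: by end_near. Qed.

Lemma cvg_inv1D2 A : A * (1 + x) ^- 2 @[x --> +oo] --> (0 : R).
Proof.
rewrite -(mulr0 A); apply: cvgM; first exact: cvg_cst.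
apply/cvgrPdist_lt => e e0; near=> x.
have x0 : 0 < x by near: x; apply: nbhs_pinfty_gt; rewrite num_real.
have x1 : 1 < 1 + x by rewrite ltrDl.
have xp : 0 < 1 + x by rewrite addr_gt0.
rewrite sub0r normrN ger0_norm ?invr_ge0 ?exprn_ge0 ?ltW//.
rewrite invf_plt ?posrE ?exprn_gt0//.
have : e^-1 < x by near: x; apply: nbhs_pinfty_gt; rewrite num_real.
move=> /lt_le_trans; apply; rewrite (@le_trans _ _ (1 + x)) ?lerDr//.
by rewrite expr2 ler_peMr ?ltW.
Unshelve. all: by end_near. Qed.

(** The sum of the two integrands is the derivative of x^z g(x), which tends to 0 at both ends. *)
Lemma mellin_by_parts z N A g g' : 0 < Re z -> Re z + 2 <= N%:R -> 0 <= A ->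
  oy_derivative g g' -> oy_continuous g' ->
  (forall x, 0 < x -> normc (g x) * (1 + x) ^+ N <= A) ->
  (forall x, 0 < x -> normc (g' x) * (1 + x) ^+ N <= A) ->
  z * cintegral oo (fun x => cpow x (z - 1) * g x) =
  - cintegral oo (fun x => cpow x z * g' x).
Proof.
move=> z0 zN A0 dg cg gA gA'.
have mg : cmeasurable oo g.
  by apply: cmeasurable_oy => x /(oy_derivative_continuous dg)[].
have mg' : cmeasurable oo g' by apply: cmeasurable_oy => x /cg[].
have kz : kernel (Re z) N 1 (fun x => cpow x (z - 1)) by apply: kernel_mellin => //; lra.
have kz1 : kernel (Re z) N 1 (fun x => cpow x z).
  have {2}-> : z = z + 1 - 1 by rewrite addrK.
  by apply: kernel_mellin => //; rewrite !cReImE /=; lra.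
have i1 := kernel_cintegrable z0 kz mg gA.
have i2 := kernel_cintegrable z0 kz1 mg' gA'.
apply/eqP; rewrite -subr_eq0 opprK -cintegral_linear//.
(* In the minimum bounding |x^z g(x)| the first entry gives the limit at 0 and the second the limit
   at infinity. *)
apply/eqP; apply: (@cintegral_derivative0 (fun x => cpow x z * g x) _ (Re z)
  ((normc z + 1) * A) (fun x => A * Num.min (x `^ Re z) ((1 + x) ^- 2)));
  first exact: z0.
- by rewrite mulr_ge0 ?addr_ge0 ?normc_ge0.
- move=> x x0; have := oy_derivativeM (oy_derivative_cpow z) dg x0.
  by rewrite mulrA.
- apply: oy_continuousD.
    apply: oy_continuousM; first exact: oy_continuous_cst.
    apply: oy_continuousM; last exact: oy_derivative_continuous dg.
    exact: oy_derivative_continuous (oy_derivative_cpow _).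
  apply: oy_continuousM; last exact: cg.
  exact: oy_derivative_continuous (oy_derivative_cpow _).
- move=> x x0; rewrite (le_trans (le_normcD _ _))// normcM [_ * A]mulrDl mulrDl lerD//.
    rewrite -!mulrA ler_wpM2l ?normc_ge0//.
    by have := kernel_dominated kz gA x0; rewrite mul1r.
  exact: (kernel_dominated kz1 gA' x0).
- move=> x x0; rewrite normcM normc_cpow//.
  have x1 : 0 < 1 + x by rewrite addr_gt0.
  have gx := gA _ x0.
  have g0 : normc (g x) <= A.
    by apply: le_trans gx; rewrite ler_peMr ?normc_ge0// exprn_ege1// lerDl ltW.
  rewrite minr_pMr// le_min; apply/andP; split; first by rewrite mulrC ler_wpM2r ?powR_ge0.
  (* With a = 1 the weight is (1 + x)^(-2), and the exponent b = Re z + 1 is where N >= Re z + 2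
     enters. *)
  have := @powR_le_wt R 1 (Re z + 1) x N ltr01; rewrite addrK => xw.
  have {}xw : x `^ Re z <= wt 1 x * (1 + x) ^+ N by apply: xw => //; lra.
  rewrite (le_trans (ler_wpM2r (normc_ge0 _) xw))// wt1.
  rewrite [leLHS](_ : _ = (normc (g x) * (1 + x) ^+ N) * (1 + x) ^- 2); last by ring.
  by rewrite ler_wpM2r// invr_ge0 exprn_ge0// ltW.
- apply: (@squeeze_cvgr _ _ _ _ (fun=> 0) (fun x => A * x `^ Re z)).
  + near=> x; rewrite mulr_ge0/= ?ler_wpM2l// ?ge_min ?lexx// le_min powR_ge0/=.
    by rewrite invr_ge0 exprn_even_ge0.
  + exact: cvg_cst.
  + by rewrite -[X in _ --> X](mulr0 A); apply: cvgM; [exact: cvg_cst|exact: powR_cvg0].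
- apply: (@squeeze_cvgr _ _ _ _ (fun=> 0) (fun x => A * (1 + x) ^- 2)).
  + near=> x; rewrite mulr_ge0/= ?ler_wpM2l// ?ge_min ?lexx ?orbT// le_min powR_ge0/=.
    by rewrite invr_ge0 exprn_even_ge0.
  + exact: cvg_cst.
  + exact: cvg_inv1D2.
Unshelve. all: by end_near. Qed.

(** * Functional equation and holomorphy of Gamma *)

Local Notation E := (fun x : R => (expR (- x))%:C).

Lemma oy_derivative_expRN : oy_derivative E (fun x => - E x).
Proof.
move=> x x0; split => /=; last by rewrite oppr0; exact: is_derive_cst.
have := is_derive1_comp (is_derive_expR (- x)) (is_deriveNid x (1:R)).
by rewrite mulrN1.
Qed.

Lemma expRN_bound N : exists2 A, 0 <= A &
  forall x, 0 < x -> normc (E x) * (1 + x) ^+ N <= A.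
Proof.
have [A A0 HA] := @expR_decay R N; exists A => // x x0.
by rewrite normc_real ger0_norm ?expR_ge0// mulrC HA// ltW.
Qed.

Lemma cmeasurable_expRN : cmeasurable oo E.
Proof.
apply: cmeasurable_oy => x x0; have [d1 d2] := oy_derivative_expRN x0.
  exact: derive_continuous d1.
exact: derive_continuous d2.
Qed.

Lemma cGammaS z : 0 < Re z -> cGamma (z + 1) = z * cGamma z.
Proof.
move=> z0; pose N := (Num.truncn (Re z + 2)).+1.
have zN : Re z + 2 <= N%:R by apply/ltW; rewrite truncnS_gt.
have [A A0 HA] := expRN_bound N.
rewrite /cGamma addrK (mellin_by_parts z0 zN A0 oy_derivative_expRN _ HA).
- rewrite (_ : (fun x => cpow x z * - E x) = (fun x => -1 * (cpow x z * E x))); last first.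
    by apply/funext => x; rewrite mulN1r mulrN.
  rewrite cintegralZ ?mulN1r ?opprK//.
  have kz1 : kernel (Re z) N 1 (fun x => cpow x z).
    have {2}-> : z = z + 1 - 1 by rewrite addrK.
    by apply: kernel_mellin => //; rewrite !cReImE /=; lra.
  exact: (kernel_cintegrable z0 kz1 cmeasurable_expRN HA).
- rewrite (_ : (fun x => - E x) = (fun x => -1 * E x)); last by apply/funext => x; rewrite mulN1r.
  apply: oy_continuousM; first exact: oy_continuous_cst.
  exact: oy_derivative_continuous oy_derivative_expRN.
- by move=> x x0; rewrite normcN; exact: HA.
Qed.

(** Integration against e^(-x) is another bounded linear functional on kernels, so
    [mellin_derivable] applies again. *)
Lemma cGamma_derivable z : 0 < Re z -> derivable ((@cGamma R) : C^o -> C^o) z 1.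
Proof.
move=> z0; have [a [N [a0 az zN]]] := mellin_order z0.
have [A A0 HA] := expRN_bound N.
have kE B k (kk : kernel a N B k) := kernel_cintegrable a0 kk cmeasurable_expRN HA.
apply: (@mellin_derivable R (fun k => cintegral oo (fun x => k x * E x)) z a N (2 * (A / a))) => //.
- by rewrite mulr_ge0// divr_ge0// ltW.
- move=> w A1 A2 k1 k2 kk1 kk2; rewrite -cintegral_linear; first last.
  + exact: (kE _ _ kk2).
  + exact: (kE _ _ kk1).
  + exact: measurable_oo0.
  by apply: eq_cintegral => x _; rewrite mulrDl mulrA.
- move=> B k kk; rewrite (le_trans (kernel_cintegral_le a0 kk cmeasurable_expRN HA))//.
  by apply: le_of_eq; ring.
Qed.

End Gamma.

(** * Gamma has no zero in the right half-plane *)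

Section GammaNonvanishing.
Variable R : realType.
Local Notation C := (R[i]).
Local Notation Re := (@complex.Re R).
Local Notation Im := (@complex.Im R).
Local Notation mu := (@lebesgue_measure R).
Local Notation oo := (`]0, +oo[%classic : set R).
Implicit Types (z w : C) (x y a A M t u : R) (N : nat).

Definition rGamma y : R := Re (cGamma y%:C).

Definition rGamma_integrand y x : R := x `^ (y - 1) * expR (- x).

Lemma rGamma_integrandE y :
  rGamma_integrand y = Re \o (fun x => cpow x (y%:C - 1) * (expR (- x))%:C).
Proof.
have e : y%:C - 1 = (y - 1)%:C by rewrite rmorphB rmorph1.
by apply/funext => x; rewrite /comp e cpow_real cReM /= mulr0 subr0.
Qed.

Lemma cGamma_cintegrable z : 0 < Re z ->
  cintegrable oo (fun x => cpow x (z - 1) * (expR (- x))%:C).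
Proof.
move=> z0; have [a [N [a0 az zN]]] := mellin_order z0.
have [A A0 HA] := @expRN_bound R N.
have kz : kernel a N 1 (fun x => cpow x (z - 1)) by apply: kernel_mellin => //; lra.
exact: (kernel_cintegrable a0 kz (@cmeasurable_expRN R) HA).
Qed.

Lemma rGamma_integrable y : 0 < y -> mu.-integrable oo (EFin \o rGamma_integrand y).
Proof. by move=> y0; rewrite rGamma_integrandE; case: (@cGamma_cintegrable y%:C y0). Qed.

Lemma rGammaE y : rGamma y = Rintegral mu oo (rGamma_integrand y).
Proof. by rewrite rGamma_integrandE. Qed.

Lemma rGammaS y : 0 < y -> rGamma (y + 1) = y * rGamma y.
Proof.
move=> y0; rewrite /rGamma rmorphD rmorph1 cGammaS// cReM /=.
by rewrite mul0r subr0.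
Qed.

Lemma rGamma_pred y : 0 < y - 1 -> rGamma y = (y - 1) * rGamma (y - 1).
Proof. by move=> /rGammaS; rewrite subrK. Qed.

(** On [1, 2] the integrand is at least e^(-2), because the exponent y - 1 is nonnegative. *)
Lemma rGamma_gt0 y : 1 <= y -> 0 < rGamma y.
Proof.
move=> y1; rewrite rGammaE.
have y0 : 0 < y by exact: lt_le_trans y1.
have iy := rGamma_integrable y0.
have m12 : measurable (`[1, 2]%classic : set R) by exact: measurable_itv.
have s12 : (`[1, 2]%classic : set R) `<=` oo.
  by move=> x /=; rewrite !in_itv/= andbT => /andP[x1 _]; exact: lt_le_trans x1.
have i2 : mu.-integrable (`[1, 2]%classic : set R) (EFin \o rGamma_integrand y).
  by apply: (@integrableS _ (measurableTypeR R) R mu oo) => //; exact: measurable_itv.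
apply: (@lt_le_trans _ _ (Rintegral mu `[1, 2] (rGamma_integrand y))); last first.
  rewrite /Rintegral fine_le//.
  - by apply: integrable_fin_num.
  - by apply: integrable_fin_num => //; exact: measurable_itv.
  - apply: ge0_subset_integral => //; first exact: (measurable_int mu iy).
    by move=> x _; rewrite lee_fin mulr_ge0 ?powR_ge0 ?expR_ge0.
apply: (@lt_le_trans _ _ (Rintegral mu (`[1, 2]%classic : set R) (fun=> expR (-2)))).
  rewrite Rintegral_cst//= lebesgue_measure_itv/= lte_fin ltr1n -EFinB /=.
  by rewrite mulr_gt0 ?expR_gt0//; lra.
apply: le_Rintegral => //.
  apply/integrableP; split; first exact: measurable_cst.
  rewrite /= integral_cst//= lebesgue_measure_itv/= lte_fin ltr1n.
  by rewrite -EFinB -EFinM ltry.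
move=> x; rewrite /= in_itv/= => /andP[x1 x2].
rewrite -[leLHS]mul1r ler_pM ?expR_ge0// ?ler_expR ?lerN2//.
by rewrite -[leLHS](powRr0 x) ler_powR// subr_ge0.
Qed.

(** With w = (ln u)/2 the claim becomes w^2 <= (e^w - e^(-w))^2, and the lower bound 1 + t <= e^t
    gives |w| <= |e^w - e^(-w)|. *)
Lemma sqr_ln_le u : 0 < u -> ln u ^+ 2 <= 4 * (u - 2 + u^-1).
Proof.
move=> u0; pose w := ln u / 2.
have uE : u = expR w * expR w by rewrite -expRD /w -splitr lnK.
have e0 := expR_gt0 w.
have -> : u - 2 + u^-1 = (expR w - expR (- w)) ^+ 2.
  by rewrite uE expRN; field; rewrite gt_eqF.
have -> : ln u ^+ 2 = 4 * w ^+ 2 by rewrite /w; field.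
rewrite ler_pM2l// -[w ^+ 2]real_normK ?num_real// -[leRHS]real_normK ?num_real//.
rewrite lerXn2r ?nnegrE//.
have h1 := expR_ge1Dx w; have h2 := expR_ge1Dx (- w).
case: (leP 0 w) => w0.
  have h3 : expR (- w) <= 1 by rewrite expR_le1 oppr_le0.
  by rewrite !ger0_norm//; lra.
have h3 : expR w <= 1 by rewrite expR_le1 ltW.
rewrite ltr0_norm// distrC ger0_norm; lra.
Qed.

(* Rotated by [M ^ (- i Im z)] with [M = Re z - 1], the integrand of [cGamma z] has
   real part [x ^ (Re z - 1) e ^ (- x) cos (Im z * ln (x / M))], and
   [cos t >= 1 - t ^ 2] with [ln u ^ 2 <= 4 (u - 2 + 1 / u)] bounds the integral
   below by [rGamma (Re z) * (1 - 4 (Im z) ^ 2 / M)]. *)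
Lemma cGamma_neq0_large z : 2 <= Re z -> 4 * Im z ^+ 2 < Re z - 1 -> cGamma z != 0.
Proof.
move=> z2 zM; apply/negP => /eqP z0.
set s := Re z; set y := Im z; pose M := s - 1.
have M0 : 0 < M by rewrite /M /s; lra.
have s0 : 0 < s by rewrite /s; lra.
have s1 : 0 < s - 1 by [].
pose c : C := cpow M (0 +i* (- y)).
have : Re (cintegral oo (fun x => c * (cpow x (z - 1) * (expR (- x))%:C))) = 0.
  rewrite cintegralZ; [|exact: measurable_itv|exact: cGamma_cintegrable].
  by rewrite -/(cGamma z) z0 mulr0.
rewrite /cintegral /=.
have ic : mu.-integrable oo (EFin \o (Re \o (fun x => c * (cpow x (z - 1) * (expR (- x))%:C)))).
  have i1 := cGamma_cintegrable s0.
  have iz : cintegrable oo (fun=> 0 : C) by split; exact: integrable0.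
  have [+ _] := cintegrable_linear c (@measurable_itv R `]0, +oo[) i1 iz.
  by apply: eq_integrable => // x _ /=; rewrite addr0.
set I := Rintegral _ _ _ => I0.
(* This minorant is the integrand of Gamma at s times 1 - 4 y^2 (x/M - 2 + M/x): the factors x and
   1/x shift s by one, so its integral is a combination of Gamma values. *)
pose low x := (1 + 8 * y ^+ 2) * rGamma_integrand s x -
  4 * y ^+ 2 * (M^-1 * rGamma_integrand (s + 1) x + M * rGamma_integrand (s - 1) x).
have mo : measurable oo by exact: measurable_itv.
have g0 := rGamma_integrable s0.
have g1 := rGamma_integrable s1.
have g2 : mu.-integrable oo (EFin \o rGamma_integrand (s + 1)).
  by apply: rGamma_integrable; rewrite addr_gt0.
have j1 : mu.-integrable oo (EFin \o (fun x => M^-1 * rGamma_integrand (s + 1) x)).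
  exact: integrable_EFinZ.
have j2 : mu.-integrable oo (EFin \o (fun x => M * rGamma_integrand (s - 1) x)).
  exact: integrable_EFinZ.
have j3 := integrable_EFinD mo j1 j2.
have j4 := integrable_EFinZ (4 * y ^+ 2) mo j3.
have j5 := integrable_EFinZ (1 + 8 * y ^+ 2) mo g0.
have il : mu.-integrable oo (EFin \o low) by exact: integrable_EFinB.
have lI : Rintegral mu oo low <= I.
  apply: le_Rintegral => // x; rewrite /= in_itv/= andbT => x0.
  have xn0 (p : bool) : p ==> (x != 0) by apply/implyP => _; rewrite gt_eqF.
  rewrite [leRHS](_ : _ = rGamma_integrand s x * cos (y * (ln x - ln M))); last first.
    rewrite !cReImE /= powRr0 oppr0 addr0 -/s -/y /rGamma_integrand.
    by rewrite mulNr cosN sinN [y * (_ - _)]mulrBr cosB; ring.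
  have r1 : rGamma_integrand (s + 1) x = x * rGamma_integrand s x.
    rewrite /rGamma_integrand mulrA; congr (_ * _).
    by rewrite [s + 1 - 1]addrAC (@powRD R x (s - 1) 1 (xn0 _)) powRr1 1?mulrC// ltW.
  have r2 : rGamma_integrand (s - 1) x = x^-1 * rGamma_integrand s x.
    rewrite /rGamma_integrand mulrA; congr (_ * _).
    by rewrite (@powRD R x (s - 1) (-1) (xn0 _)) powR_inv1 1?mulrC// ltW.
  rewrite /low r1 r2.
  have q0 : 0 <= rGamma_integrand s x by rewrite mulr_ge0 ?powR_ge0 ?expR_ge0.
  have := normr_cosB1_le (y * (ln x - ln M)).
  rewrite ler_norml => /andP[+ _]; rewrite exprMn -ln_div ?posrE// => hc.
  have hl := sqr_ln_le (divr_gt0 x0 M0).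
  have := ler_wpM2l (sqr_ge0 y) hl => {}hl.
  have : 1 - y ^+ 2 * (4 * (x / M - 2 + (x / M)^-1)) <= cos (y * ln (x / M)) by lra.
  move=> /(ler_wpM2l q0); apply: le_trans.
  by apply: le_of_eq; field; rewrite !gt_eqF.
(* As s = M + 1, the functional equation turns the bracket into (2 + 1/M) Gamma(s), and the 2
   cancels against 8 y^2. *)
have El : Rintegral mu oo low = rGamma s * (1 - 4 * y ^+ 2 / M).
  rewrite /low RintegralB// RintegralZl// RintegralZl// RintegralD// !RintegralZl//.
  rewrite -!rGammaE rGammaS//.
  have -> : rGamma s = M * rGamma (s - 1) by exact: rGamma_pred.
  have sM : s = M + 1 by rewrite /M subrK.
  move: (rGamma (s - 1)) => G; rewrite sM; move: M0; clear; move: M => M M0.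
  by field; rewrite gt_eqF.
have : 0 < rGamma s * (1 - 4 * y ^+ 2 / M).
  rewrite mulr_gt0 ?rGamma_gt0//; first by rewrite /s; lra.
  by rewrite subr_gt0 ltr_pdivrMr// mul1r.
by rewrite -El; lra.
Qed.

Lemma cGamma_neq0 z : 0 < Re z -> cGamma z != 0.
Proof.
move=> z0; apply/negP => /eqP Gz.
have H n : cGamma (z + n%:R) = 0.
  elim: n => [|n IH]; first by rewrite addr0.
  rewrite -natr1 addrA cGammaS ?IH ?mulr0//.
  by rewrite cReD Re_nat ltr_wpDr.
(* This shift secures both hypotheses of [cGamma_neq0_large], since Re z is positive and Im z is
   unchanged. *)
pose n := (Num.truncn (2 + 4 * Im z ^+ 2)).+1.
have nn : 2 + 4 * Im z ^+ 2 < n%:R by rewrite truncnS_gt.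
have := @cGamma_neq0_large (z + n%:R).
rewrite H eqxx cReD cImD Re_nat Im_nat addr0 => F; suff : false by []; apply: F.
  by have := sqr_ge0 (Im z); lra.
by lra.
Qed.

End GammaNonvanishing.

(** * Schwartz functions *)

Section Schwartz.
Variable R : realType.
Local Notation C := (R[i]).
Local Notation Re := (@complex.Re R).
Local Notation Im := (@complex.Im R).
Local Notation mu := (@lebesgue_measure R).
Local Notation oo := (`]0, +oo[%classic : set R).
Implicit Types (s z w : C) (x y a A t u P : R) (n k N M : nat) (f g : R -> C).

Lemma derive1n_shift n (h : R -> R) t :
  derive1n n (fun x => h (x + t)) = (fun x => derive1n n h (x + t)).
Proof.
elim: n => // n IH; rewrite !derive1nS IH; apply/funext => x.
rewrite /derive1 /=.
have -> : (fun e : R => e^-1 *: (derive1n n h (e + x + t) - derive1n n h (x + t))) =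
    (fun e : R => e^-1 *: (derive1n n h (e + (x + t)) - derive1n n h (x + t))).
  by apply/funext => e; rewrite addrA.
by [].
Qed.

Lemma cderiven_shift n f t :
  cderiven n (fun x => f (x + t)) = (fun x => cderiven n f (x + t)).
Proof.
apply/funext => x; rewrite /cderiven.
by rewrite (derive1n_shift n (Re \o f) t) (derive1n_shift n (Im \o f) t).
Qed.

Definition rsmooth (h : R -> R) := forall n x, derivable (derive1n n h) x 1.

(** The shape p h1 + q h2 + h3 covers both components of z f + g, each of which mixes the two parts
    of f with one part of g. *)
Lemma derive1n_linear n (p q : R) (h1 h2 h3 : R -> R) :
  rsmooth h1 -> rsmooth h2 -> rsmooth h3 ->
  derive1n n (fun x => p * h1 x + q * h2 x + h3 x) =
  (fun x => p * derive1n n h1 x + q * derive1n n h2 x + derive1n n h3 x) /\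
  (forall x, derivable (derive1n n (fun x => p * h1 x + q * h2 x + h3 x)) x 1).
Proof.
move=> s1 s2 s3.
have D m x : is_derive x 1 (fun x => p * derive1n m h1 x + q * derive1n m h2 x + derive1n m h3 x)
    (p * derive1n m.+1 h1 x + q * derive1n m.+1 h2 x + derive1n m.+1 h3 x).
  have d1 := derivableP (s1 m x); have d2 := derivableP (s2 m x); have d3 := derivableP (s3 m x).
  rewrite !derive1nS !derive1E.
  exact: (is_deriveD (is_deriveD (is_deriveZ p d1) (is_deriveZ q d2)) d3).
have E : derive1n n (fun x => p * h1 x + q * h2 x + h3 x) =
    (fun x => p * derive1n n h1 x + q * derive1n n h2 x + derive1n n h3 x).
  elim: n => // n IH; rewrite derive1nS IH; apply/funext => x.
  by rewrite derive1E; have := D n x => d; rewrite derive_val.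
split => // x; rewrite E; by have [] := D n x.
Qed.

Lemma csmoothP f : csmooth f <-> rsmooth (Re \o f) /\ rsmooth (Im \o f).
Proof.
split => [H|[H1 H2]]; first by split => n x; have [] := H n x.
by move=> n x; split; [exact: H1|exact: H2].
Qed.

Lemma Re_linear z f g :
  Re \o (fun x => z * f x + g x) =
  (fun x => Re z * (Re \o f) x + (- Im z) * (Im \o f) x + (Re \o g) x).
Proof. by apply/funext => x /=; rewrite !cReImE mulNr. Qed.

Lemma Im_linear z f g :
  Im \o (fun x => z * f x + g x) =
  (fun x => Re z * (Im \o f) x + Im z * (Re \o f) x + (Im \o g) x).
Proof. by apply/funext => x /=; rewrite !cReImE. Qed.

Lemma csmooth_linear z f g : csmooth f -> csmooth g -> csmooth (fun x => z * f x + g x).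
Proof.
move=> /csmoothP[f1 f2] /csmoothP[g1 g2]; apply/csmoothP; split => n x.
  by rewrite Re_linear; exact: (derive1n_linear n (Re z) (- Im z) f1 f2 g1).2.
by rewrite Im_linear; exact: (derive1n_linear n (Re z) (Im z) f2 f1 g2).2.
Qed.

Lemma cderiven_linear n z f g : csmooth f -> csmooth g ->
  cderiven n (fun x => z * f x + g x) = (fun x => z * cderiven n f x + cderiven n g x).
Proof.
move=> /csmoothP[f1 f2] /csmoothP[g1 g2]; apply/funext => x; apply: complex_ext.
  rewrite /cderiven /= Re_linear (derive1n_linear n (Re z) (- Im z) f1 f2 g1).1.
  by rewrite !cReImE /= mulNr.
rewrite /cderiven /= Im_linear (derive1n_linear n (Re z) (Im z) f2 f1 g2).1.
by rewrite !cReImE /=.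
Qed.

Lemma cderiven_cderivative n f : csmooth f -> cderivative (cderiven n f) (cderiven n.+1 f).
Proof.
move=> /csmoothP[f1 f2]; split => u.
  by have := derivableP (f1 n u); rewrite -derive1E -derive1nS.
by have := derivableP (f2 n u); rewrite -derive1E -derive1nS.
Qed.

(** According to whether y <= 1, the left side is at most 2^M or (2y)^M. This turns the weights
    |x|^m of the seminorms into powers of 1 + |x|. *)
Lemma exp1D_le y M : 0 <= y -> (1 + y) ^+ M <= 2 ^+ M * (1 + y ^+ M).
Proof.
move=> y0; rewrite mulrDr mulr1 -exprMn; case: (leP y 1) => y1.
  rewrite (@le_trans _ _ (2 ^+ M))// ?lerDl ?exprn_ge0 ?mulr_ge0//.
  by rewrite lerXn2r ?nnegrE ?addr_ge0//; lra.
rewrite (@le_trans _ _ ((2 * y) ^+ M))// ?lerDr ?exprn_ge0//.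
by rewrite lerXn2r ?nnegrE ?addr_ge0 ?mulr_ge0//; lra.
Qed.

Lemma decay_weights M n f A : (forall x, normc (cderiven n f x) <= A) ->
  (forall x, `|x| ^+ M * normc (cderiven n f x) <= A) ->
  decay M (2 ^+ M * (2 * A)) (cderiven n f).
Proof.
move=> b0 bM u; rewrite mulrC.
rewrite (le_trans (ler_wpM2r (normc_ge0 _) (exp1D_le M (normr_ge0 u))))//.
rewrite -mulrA ler_wpM2l ?exprn_ge0// mulrDl mul1r mulr_natl mulr2n.
by apply: lerD.
Qed.

(** The Schwartz condition with weights (1 + |u|)^M and existential bounds in place of suprema, as
    the convolution estimates consume it. *)
Definition rapid f := csmooth f /\ forall n M, exists P, decay M P (cderiven n f).

Lemma schwartz_weights_le m n f x : schwartz f ->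
  `|x| ^+ m * normc (cderiven n f x) <= schwartz_seminorm m n f.
Proof. by move=> [_ /(_ m n) ub]; apply: ub_le_sup => //; exists x. Qed.

Lemma schwartz_decay M n f A : schwartz f ->
  schwartz_seminorm 0 n f <= A -> schwartz_seminorm M n f <= A ->
  decay M (2 ^+ M * (2 * A)) (cderiven n f).
Proof.
move=> sf A0 AM; apply: decay_weights => x.
  by apply: le_trans A0; have := schwartz_weights_le 0 n x sf; rewrite expr0 mul1r.
by apply: le_trans AM; exact: schwartz_weights_le.
Qed.

Lemma schwartz_rapid f : schwartz f -> rapid f.
Proof.
move=> sf; split; first by case: sf.
move=> n M; pose A := Num.max (schwartz_seminorm 0 n f) (schwartz_seminorm M n f).
exists (2 ^+ M * (2 * A)).
by apply: schwartz_decay => //; rewrite le_max lexx ?orbT.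
Qed.

Lemma schwartz_linear z f g : schwartz f -> schwartz g ->
  schwartz (fun x => z * f x + g x).
Proof.
move=> sf sg; have [cf _] := sf; have [cg _] := sg; split; first exact: csmooth_linear.
move=> m n; exists (normc z * schwartz_seminorm m n f + schwartz_seminorm m n g).
move=> _ [x _ <-]; rewrite cderiven_linear//.
rewrite (le_trans (ler_wpM2l _ (le_normcD _ _))) ?exprn_ge0// normcM mulrDr lerD//.
  by rewrite mulrCA ler_wpM2l ?normc_ge0// schwartz_weights_le.
exact: schwartz_weights_le.
Qed.

(** Translation commutes with derivatives, and Peetre's inequality moves the weight from u to u + t
    at the price (1 + |t|)^M. *)
Lemma rapid_shift f t : rapid f -> rapid (fun x => f (x + t)).
Proof.
move=> [cf df]; split.
  move=> n x; have H (q : C -> R) : derivable (derive1n n (q \o f)) (x + t) 1 ->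
      derivable (derive1n n (q \o (fun x => f (x + t)))) x 1.
    move=> d; rewrite (derive1n_shift n (q \o f) t).
    have ds : is_derive x 1 (fun y : R => y + t) 1 by exact: is_derive_shift.
    by have [] := @is_derive1_comp R _ (fun y : R => y + t) x _ _ (derivableP d) ds.
  by have [d1 d2] := cf n (x + t); split; apply: H.
move=> n M; have [P dP] := df n M; exists (P * (1 + `|t|) ^+ M).
rewrite cderiven_shift => u.
have ut : `| `|u + t| - `|u| | <= `|t|.
  by rewrite (le_trans (ler_dist_dist _ _))// addrAC subrr add0r.
have := peetre M (normr_ge0 u) ut; rewrite normr_id => up.
rewrite (le_trans (ler_wpM2l (normc_ge0 _) up))// mulrCA mulrC.
by rewrite ler_wpM2r ?exprn_ge0 ?addr_ge0.
Qed.

Lemma rapid_order k f z : rapid f -> 0 < Re z ->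
  exists a N P, [/\ 0 < a, kernel a N 1 (fun x => cpow x (z - 1)),
    decay (N + 2) P (cderiven k f) & decay (N + 2) P (cderiven k.+1 f)].
Proof.
move=> [_ df] z0; have [a [N [a0 az zN]]] := mellin_order z0.
have [P1 d1] := df k (N + 2)%N; have [P2 d2] := df k.+1 (N + 2)%N.
exists a, N, (Num.max P1 P2); split => //.
- by apply: kernel_mellin => //; lra.
- by move=> u; rewrite le_max d1.
- by move=> u; rewrite le_max d2 orbT.
Qed.

(** With z = s + k, integration by parts produces the factor -z; the sign goes into (-1)^(k+1) and z
    cancels against Gamma(z + 1) = z Gamma(z). *)
Lemma gamma_plus_atS k s f : rapid f -> - k%:R < Re s ->
  gamma_plus_at k.+1 s f = gamma_plus_at k s f.
Proof.
move=> [cf df] ks; set z := s + k%:R.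
have z0 : 0 < Re z by rewrite /z cReD Re_nat; lra.
pose N := (Num.truncn (Re z + 2)).+1.
have zN : Re z + 2 <= N%:R by apply/ltW; rewrite truncnS_gt.
have [P1 d1] := df k N; have [P2 d2] := df k.+1 N.
have dk := cderiven_cderivative k cf.
have [c1 c2] := cderivative_continuous (cderiven_cderivative k.+1 cf).
have := @mellin_by_parts R z N (Num.max P1 P2) (cderiven k f) (cderiven k.+1 f) z0 zN.
move=> /(_ _ _ _ _ _) H.
have {}H : z * cintegral oo (fun x => cpow x (z - 1) * cderiven k f x) =
    - cintegral oo (fun x => cpow x z * cderiven k.+1 f x).
  apply: H.
  - by rewrite le_max (decay_ge0 d1).
  - by move=> x x0; have [e1 e2] := dk; split; [exact: e1|exact: e2].
  - by move=> x x0; split; [exact: c1|exact: c2].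
  - by move=> x x0; have := d1 x; rewrite (gtr0_norm x0) le_max => ->.
  - by move=> x x0; have := d2 x; rewrite (gtr0_norm x0) le_max => ->; rewrite orbT.
have zn0 : z != 0 by apply: contraTneq z0 => ->; rewrite ltxx.
have Gn0 := cGamma_neq0 z0.
rewrite /gamma_plus_at -natr1 addrA -/z cGammaS// addrK.
have {H} -> : cintegral oo (fun x => cpow x z * cderiven k.+1 f x) =
    - (z * cintegral oo (fun x => cpow x (z - 1) * cderiven k f x)) by rewrite H opprK.
move: (cGamma z) Gn0 (cintegral _ _) zn0 => G Gn0 I zn0.
rewrite exprS mulN1r mulNr mulrNN invfM -!mulrA; congr (_ * _).
by rewrite mulrCA mulKf.
Qed.

Lemma gamma_plusE k s f : rapid f -> - k%:R < Re s ->
  gamma_plus s f = gamma_plus_at k s f.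
Proof.
move=> rf; rewrite gamma_orderP => /subnK <-.
elim: (k - _)%N => // d ->; rewrite addSn gamma_plus_atS// gamma_orderP.
exact: leq_addl.
Qed.

(** * Translates of gamma_+^s and their principal value *)

Definition gamma_coeff k s : C := (-1) ^+ k / cGamma (s + k%:R).

Local Notation mellin z := (fun x => cpow x (z - 1)).

(** Any admissible [k] is allowed: [gamma_order] jumps as s varies, whereas here one order serves a
    whole half-plane. *)
Lemma gamma_plus_shiftE k s f : rapid f -> - k%:R < Re s ->
  gamma_plus_shift s f =
  (fun t => gamma_coeff k s * conv (mellin (s + k%:R)) (cderiven k f) t).
Proof.
move=> rf ks; apply/funext => t; rewrite /gamma_plus_shift.
rewrite (gamma_plusE (rapid_shift t rf) ks) /gamma_plus_at /gamma_coeff /conv.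
by rewrite cderiven_shift.
Qed.

Lemma gamma_plus_shift_pv_bound s f : rapid f ->
  exists N K, pv_bound N K (gamma_plus_shift s f).
Proof.
move=> rf; have [cf _] := rf; pose k := gamma_order s.
have ks : - k%:R < Re s by rewrite gamma_orderP.
have z0 : 0 < Re (s + k%:R) by rewrite cReD Re_nat; lra.
have [a [N [P [a0 kz d1 d2]]]] := rapid_order k rf z0.
have pb := conv_pv_bound a0 kz (cderiven_cderivative k cf) d1 d2.
exists N, (normc (gamma_coeff k s) * (4 * (1 * P / a))).
by rewrite (gamma_plus_shiftE rf ks); exact: pv_boundZ.
Qed.

Lemma gamma_li0E k s f : rapid f -> - k%:R < Re s ->
  gamma_li0 s f = gamma_coeff k s * li0 (conv (mellin (s + k%:R)) (cderiven k f)).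
Proof.
move=> rf ks; have [cf _] := rf.
have z0 : 0 < Re (s + k%:R) by rewrite cReD Re_nat; lra.
have [a [N [P [a0 kz d1 d2]]]] := rapid_order k rf z0.
have pb := conv_pv_bound a0 kz (cderiven_cderivative k cf) d1 d2.
by rewrite /gamma_li0 (gamma_plus_shiftE rf ks) (li0Z _ pb).
Qed.

Lemma gamma_li0_linear s z f g : rapid f -> rapid g -> rapid (fun x => z * f x + g x) ->
  gamma_li0 s (fun x => z * f x + g x) = z * gamma_li0 s f + gamma_li0 s g.
Proof.
move=> rf rg rfg; have [cf df] := rf; have [cg dg] := rg; pose k := gamma_order s.
have ks : - k%:R < Re s by rewrite gamma_orderP.
have z0 : 0 < Re (s + k%:R) by rewrite cReD Re_nat; lra.
have [a [N [a0 az zN]]] := mellin_order z0.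
have kz : kernel a N 1 (mellin (s + k%:R)) by apply: kernel_mellin => //; lra.
have [P1 f1] := df k (N + 2)%N; have [P2 f2] := df k.+1 (N + 2)%N.
have [Q1 g1] := dg k (N + 2)%N; have [Q2 g2] := dg k.+1 (N + 2)%N.
have M1 : decay (N + 2) (Num.max P1 P2) (cderiven k f) by move=> u; rewrite le_max f1.
have M2 : decay (N + 2) (Num.max P1 P2) (cderiven k.+1 f) by move=> u; rewrite le_max f2 orbT.
have M3 : decay (N + 2) (Num.max Q1 Q2) (cderiven k g) by move=> u; rewrite le_max g1.
have M4 : decay (N + 2) (Num.max Q1 Q2) (cderiven k.+1 g) by move=> u; rewrite le_max g2 orbT.
have df' := cderiven_cderivative k cf; have dg' := cderiven_cderivative k cg.
have pf := conv_pv_bound a0 kz df' M1 M2; have pg := conv_pv_bound a0 kz dg' M3 M4.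
rewrite !(@gamma_li0E k)// mulrCA -mulrDr -(li0_linear z pf pg); congr (_ * li0 _).
apply/funext => t; rewrite cderiven_linear//.
exact: (conv_linear_r z t a0 kz df' M1 dg' M3).
Qed.

(** All previous bounds are linear in the decay constants, so finitely many seminorms control the
    value; by linearity this is continuity. *)
Lemma gamma_li0_le s : exists N, exists2 A, 0 <= A & forall f e, schwartz f ->
  (forall m n, (m <= N)%N -> (n <= N)%N -> schwartz_seminorm m n f <= e) ->
  normc (gamma_li0 s f) <= A * e.
Proof.
pose k := gamma_order s.
have ks : - k%:R < Re s by rewrite gamma_orderP.
have z0 : 0 < Re (s + k%:R) by rewrite cReD Re_nat; lra.
have [a [N [a0 az zN]]] := mellin_order z0.
have kz : kernel a N 1 (mellin (s + k%:R)) by apply: kernel_mellin => //; lra.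
have [B B0 HB] := @normc_li0_le R N.
(* The seminorms used have weight order 0 or N + 2 and derivative order k or k + 1. *)
exists (N + k + 3)%N; exists (normc (gamma_coeff k s) * (B * (4 * (2 ^+ (N + 2) * 2 / a)))).
  by rewrite mulr_ge0 ?normc_ge0// mulr_ge0// mulr_ge0// divr_ge0// ltW.
move=> f e sf fe; have rf := schwartz_rapid sf; have [cf _] := rf.
have d1 : decay (N + 2) (2 ^+ (N + 2) * (2 * e)) (cderiven k f).
  by apply: schwartz_decay => //; apply: fe; lia.
have d2 : decay (N + 2) (2 ^+ (N + 2) * (2 * e)) (cderiven k.+1 f).
  by apply: schwartz_decay => //; apply: fe; lia.
rewrite (gamma_li0E rf ks) normcM -[leRHS]mulrA ler_wpM2l ?normc_ge0//.
have pb := conv_pv_bound a0 kz (cderiven_cderivative k cf) d1 d2.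
rewrite (le_trans (HB _ _ pb))//.
by apply: le_of_eq; ring.
Qed.

Lemma regular_derivableM (K : numFieldType) (F G : K^o -> K^o) (s v : K^o) :
  derivable F s v -> derivable G s v -> derivable (fun w : K^o => F w * G w : K^o) s v.
Proof. by move=> dF dG; exact: (@derivableM K K^o F G s v dF dG). Qed.

Lemma regular_derivableV (K : numFieldType) (F : K^o -> K^o) (s v : K^o) :
  F s != 0 -> derivable F s v -> derivable (fun w : K^o => (F w)^-1 : K^o) s v.
Proof. by move=> F0 dF; exact: (@derivableV K K^o F s v F0 dF). Qed.

Lemma derivable_translate (F : C^o -> C^o) (s b : C^o) : derivable F (s + b) 1 ->
  derivable (fun w : C^o => F (w + b)) s 1.
Proof.
rewrite /derivable /=.
have -> : (fun h : C => h^-1 *: (F (h *: 1 + s + b) - F (s + b)) : C^o) =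
    (fun h : C => h^-1 *: (F (h *: 1 + (s + b)) - F (s + b)) : C^o).
  by apply/funext => h; rewrite addrA.
by [].
Qed.

(** Near s the value is (-1)^k times 1 / Gamma(w + k), holomorphic because Gamma has no zero there,
    times a factor covered by [li0_conv_derivable]. *)
Lemma gamma_li0_derivable f s : rapid f ->
  derivable ((fun w => gamma_li0 w f) : C^o -> C^o) s 1.
Proof.
move=> rf; have [cf df] := rf; pose k := gamma_order s.
have ks : - k%:R < Re s by rewrite gamma_orderP.
have z0 : 0 < Re (s + k%:R) by rewrite cReD Re_nat; lra.
pose G : C^o -> C^o := fun w => cGamma (w + k%:R).
pose T : C^o -> C^o := fun w => li0 (conv (mellin (w + k%:R)) (cderiven k f)).
have dG : derivable G s 1.
  by apply: (@derivable_translate (@cGamma R)); exact: cGamma_derivable.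
have dT : derivable T s 1.
  apply: (@derivable_translate (fun w => li0 (conv (mellin w) (cderiven k f)))).
  by apply: li0_conv_derivable => //; exact: cderiven_cderivative.
have G0 : G s != 0 by exact: cGamma_neq0.
have dM := regular_derivableM (regular_derivableV G0 dG) dT.
have {}dM := @derivableZ _ C^o C^o _ ((-1) ^+ k) s 1 dM.
apply: near_eq_derivable dM.
(* The disc of this radius about s lies in the half-plane Re w > -k, where the formula with the same
   [k] holds. *)
exists ((Re s + k%:R)%:C) => /=; first by rewrite ltcR; lra.
move=> w /=; rewrite distrC normc_cE ltcR => sw.
have kw : - k%:R < Re w.
  have := le_lt_trans (normc_ge_normRe _) sw; rewrite cReD cReN ltr_norml => /andP[+ _].
  by lra.
by rewrite (gamma_li0E rf kw) /gamma_coeff -mulrA.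
Qed.

End Schwartz.

(** * Existence of the principal value, temperedness and holomorphy in s *)

Theorem theorem1 (R : realType) :
  (forall (s : R[i]) (f : R -> R[i]),
     schwartz f -> li0_well_defined (gamma_plus_shift s f)) /\
  (forall s : R[i], tempered_distribution (gamma_li0 s)) /\
  (forall f : R -> R[i], schwartz f -> entire (fun s : R[i] => gamma_li0 s f)).
Proof.
split; first move=> s f /schwartz_rapid rf.
  have [N [K pb]] := gamma_plus_shift_pv_bound s rf.
  exact: pv_bound_well_defined pb.
split; last by move=> f /schwartz_rapid rf s; exact: gamma_li0_derivable.
have lin s z (f g : R -> R[i]) : schwartz f -> schwartz g ->
    gamma_li0 s (fun x => z * f x + g x) = z * gamma_li0 s f + gamma_li0 s g.
  move=> sf sg; apply: gamma_li0_linear; apply: schwartz_rapid => //.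
  exact: schwartz_linear.
move=> s; split; first by move=> z f g; exact: lin.
move=> f sf e e0; have [N [A A0 HA]] := gamma_li0_le s.
(* The bound becomes A e / (2 (A + 1)), strictly below e even when A = 0. *)
exists N; exists (e / (2 * (A + 1))); first by rewrite divr_gt0// mulr_gt0// ltr_wpDl.
move=> g sg gf.
have fgE : (fun x => -1 * f x + g x) = (fun x => g x - f x).
  by apply/funext => x; rewrite mulN1r addrC.
have -> : gamma_li0 s g - gamma_li0 s f = gamma_li0 s (fun x => g x - f x).
  by rewrite -fgE lin// mulN1r addrC.
have sd : schwartz (fun x => g x - f x) by rewrite -fgE; exact: schwartz_linear.
have := HA _ (e / (2 * (A + 1))) sd (fun m n mN nN => ltW (gf m n mN nN)).
move=> /le_lt_trans; apply.
have A1 : 0 < A + 1 by rewrite ltr_wpDl.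
rewrite mulrA ltr_pdivrMr ?mulr_gt0// mulrC ltr_pM2l//.
by lra.
Qed.
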